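(* Let $G$ act by isometries on a Gromov hyperbolic space $X$, and let $\mu$ be a countable, non-elementary, bounded, WPD probability measure on $G$. Then there are constants $B>0$ and $c<1$ such that for all $n$, $$\mathbb P(w_n\text{ is WPD})\ge 1-Bc^{\sqrt n}.$$
   Context: $X$ is a $\delta$-hyperbolic geodesic metric space, not necessarily proper; basepoint $x$. Loxodromic: $\lim d(x,g^nx)/n>0$. $\mathrm{Stab}_K(y,z)=\{g\in G:d(y,gy)\le K,d(z,gz)\le K\}$; a loxodromic $h$ is WPD if for every $K>0$ and $y\in X$ there is $M$ with $\mathrm{Stab}_K(y,h^My)$ finite. $w_n=g_1\cdots g_n$, $g_i$ i.i.d. $\sim\mu$; $\Gamma_\mu$ semigroup generated by $\mathrm{supp}\mu$. Countable: countable support; non-elementary: $\Gamma_\mu$ contains two loxodromics with disjoint fixed sets in $\partial X$; bounded: $\{gx:g\in\mathrm{supp}\mu\}$ bounded; WPD: $\Gamma_\mu$ contains an element WPD for the $G$-action. *)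

(* Defs.v *)
From Stdlib Require Import Reals List.
Open Scope R_scope.

Section Defs.
Variable X : Type.
Variable d : X -> X -> R.

Definition is_metric : Prop :=
  (forall a b, 0 <= d a b) /\ (forall a b, d a b = 0 <-> a = b) /\
  (forall a b, d a b = d b a) /\ (forall a b c, d a c <= d a b + d b c).

Definition geodesic_space : Prop :=
  forall a b, exists gam : R -> X, gam 0 = a /\ gam (d a b) = b /\
    forall s t, 0 <= s <= d a b -> 0 <= t <= d a b -> d (gam s) (gam t) = Rabs (s - t).

Definition gprod (w y z : X) : R := (d w y + d w z - d y z) / 2.

Definition hyperbolic (delta : R) : Prop :=
  0 <= delta /\ forall w a b c, gprod w a c >= Rmin (gprod w a b) (gprod w b c) - delta.

Definition same_boundary_point (x0 : X) (a b : nat -> X) : Prop :=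
  forall M, exists N, forall i j, (N <= i)%nat -> (N <= j)%nat -> gprod x0 (a i) (b j) >= M.

Variable G : Type.
Variable mul : G -> G -> G.
Variable inv : G -> G.
Variable e : G.

Definition is_group : Prop :=
  (forall a b c, mul a (mul b c) = mul (mul a b) c) /\
  (forall a, mul e a = a /\ mul a e = a) /\
  (forall a, mul (inv a) a = e /\ mul a (inv a) = e).

Variable act : G -> X -> X.

Definition isometric_action : Prop :=
  (forall y, act e y = y) /\ (forall g h y, act (mul g h) y = act g (act h y)) /\
  (forall g y z, d (act g y) (act g z) = d y z).

Fixpoint gpow (g : G) (n : nat) : G :=
  match n with O => e | S k => mul g (gpow g k) end.

Definition loxodromic (x0 : X) (g : G) : Prop :=
  exists l, 0 < l /\ Un_cv (fun n => d x0 (act (gpow g n) x0) / INR n) l.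

Definition finite_set (P : G -> Prop) : Prop :=
  exists l : list G, forall g, P g -> In g l.

Definition Stab (K : R) (y z : X) (g : G) : Prop :=
  d y (act g y) <= K /\ d z (act g z) <= K.

Definition WPD (x0 : X) (h : G) : Prop :=
  loxodromic x0 h /\
  forall K y, 0 < K -> exists M : nat, finite_set (Stab K y (act (gpow h M) y)).

(* fixed points in the boundary of a loxodromic g: classes of (g^n x0), (g^-n x0);
   the fixed sets of g and h are disjoint *)
Definition disjoint_fixed (x0 : X) (g h : G) : Prop :=
  forall u v : G, (u = g \/ u = inv g) -> (v = h \/ v = inv h) ->
    ~ same_boundary_point x0 (fun n => act (gpow u n) x0) (fun n => act (gpow v n) x0).

(* a countable probability measure on G: weights p i at points s i *)
Definition prob_measure (s : nat -> G) (p : nat -> R) : Prop :=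
  (forall i, 0 <= p i) /\ infinite_sum p 1.

Definition in_supp (s : nat -> G) (p : nat -> R) (g : G) : Prop :=
  exists i, 0 < p i /\ s i = g.

Inductive Gamma (s : nat -> G) (p : nat -> R) : G -> Prop :=
| Gamma_supp : forall g, in_supp s p g -> Gamma s p g
| Gamma_mul : forall g h, Gamma s p g -> Gamma s p h -> Gamma s p (mul g h).

Definition non_elementary (x0 : X) (s : nat -> G) (p : nat -> R) : Prop :=
  exists g h, Gamma s p g /\ Gamma s p h /\ loxodromic x0 g /\ loxodromic x0 h /\
    disjoint_fixed x0 g h.

Definition bounded_measure (x0 : X) (s : nat -> G) (p : nat -> R) : Prop :=
  exists C, forall g, in_supp s p g -> d x0 (act g x0) <= C.

Definition WPD_measure (x0 : X) (s : nat -> G) (p : nat -> R) : Prop :=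
  exists h, Gamma s p h /\ WPD x0 h.

(* walk_prob s p n A r : P(w_n in A) = r, where w_n = g_1 ... g_n, g_i iid ~ mu.
   Recursion: P(w_{n+1} in A) = sum_i p_i P(w_n in s_i^{-1} A). *)
Inductive walk_prob (s : nat -> G) (p : nat -> R) : nat -> (G -> Prop) -> R -> Prop :=
| wp_zero_in : forall A : G -> Prop, A e -> walk_prob s p O A 1
| wp_zero_out : forall A : G -> Prop, ~ A e -> walk_prob s p O A 0
| wp_succ : forall n (A : G -> Prop) (r : nat -> R) (t : R),
    (forall i, walk_prob s p n (fun g => A (mul (s i) g)) (r i)) ->
    infinite_sum (fun i => p i * r i) t ->
    walk_prob s p (S n) A t.

End Defs.

(* Main.v *)
(** Write |g| = d(x0, g x0) and w_n for the random walk.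

    Two independent loxodromics give, in a bounded number of steps, words u such that
    d(y, u z) >= d(y, x0) + 0.99 d(x0, z) - O(1) on average, for all points y and z at once.
    Hence E|w_n| is unbounded, and inserting such a word at the first opportunity shows that
    for some N the drift E[d(y, w_N x0) - d(y, x0)] is at least 0.97 E|w_N| for every y.
    As increments are bounded, exponential moments turn this into: outside an event of
    probability exponentially small in m, |w_m| is linear in m and (y | w_m x0) is at most a
    small proportion of |w_m|.

    Cut w_n into about sqrt n blocks of length about sqrt n separated by slots of bounded
    length. Outside an event of probability O(c^(sqrt n)) consecutive blocks, also cyclically,
    have small Gromov products, so the periodic path of w_n is a quasi-geodesic. Given the
    blocks, each slot independently has a definite probability of being u h^M u' with u, u'
    chosen so that the copy of h^M (h WPD) is aligned with the adjacent blocks up to a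
    constant; some slot succeeds outside probability c^(sqrt n). Then w_n is conjugate to
    h^M V with bounded Gromov products, so it is loxodromic and its axis contains a copy of
    the axis of h of length M. Such an element is WPD: a coarse stabiliser of a long piece
    of its axis moves the middle by translations, and two elements with almost the same
    translation length differ by an element of one fixed coarse stabiliser of h. *)

Require Import Defs.
From Stdlib Require Import Reals Lra Lia Arith List Classical ClassicalEpsilon.
From Coquelicot Require Import Coquelicot.
Open Scope R_scope.

(** As [X] need not be proper, no compactness of [X], boundary limit or stationary measure enters.
    Every estimate concerns Gromov products at [x0] and is uniform in an arbitrary point [y]. This
    uniformity makes conditioning harmless: freezing the part of the path already drawn only changes
    [y], so a bound over a fixed number of steps can be iterated. The rate is a balance. With blocks
    of length about k, the union bound over junctions costs about n/k times exp(-tau k), whereas all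
    of the n/k slots fail with probability (1 - alpha)^(n/k); both exponents have order sqrt n when
    k does. The delicate point in WPD is the order of quantifiers. The power M of h is fixed before
    the constant K of the definition is known, and may depend only on the ping-pong constants. Hence
    the criterion needs finiteness of a coarse stabiliser whose constant does not involve K; K only
    decides which power of w_n is taken. *)

Lemma bounded_prefix (u : nat -> R) (n : nat) :
  exists M, 0 <= M /\ forall i, (i <= n)%nat -> u i <= M.
Proof.
  induction n as [|n [M [HM0 HM]]].
  - exists (Rabs (u O)); split; [apply Rabs_pos|].
    intros i Hi; replace i with O by lia; apply Rle_abs.
  - exists (Rmax M (u (S n))); split; [apply Rle_trans with M; [easy|apply Rmax_l]|].
    intros i Hi. destruct (Nat.eq_dec i (S n)) as [->|Hne]; [apply Rmax_r|].
    apply Rle_trans with M; [apply HM; lia|apply Rmax_l].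
Qed.

Lemma archimed_nat (r : R) : exists n, r <= INR n.
Proof.
  destruct (Rle_or_lt 0 r) as [H|H].
  - destruct (nfloor_ex r H) as [n Hn]. exists (S n). rewrite S_INR; lra.
  - exists O; simpl; lra.
Qed.

Lemma pow2_unbounded (r : R) : exists j, r < 2 ^ j.
Proof.
  destruct (archimed_nat r) as [n Hn]. exists n.
  apply Rle_lt_trans with (INR n); [easy|].
  clear Hn; induction n as [|n IH]; [simpl; lra|].
  rewrite S_INR; simpl. assert (1 <= 2 ^ n) by (apply pow_R1_Rle; lra). lra.
Qed.

(** * Subadditive sequences *)

Section Subadditive.
Variable a : nat -> R.
Hypothesis a_sub : forall m n, a (m + n)%nat <= a m + a n.

Lemma subadditive_mul (n q : nat) : a O <= 0 -> a (q * n)%nat <= INR q * a n.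
Proof.
  intros H0; induction q as [|q IH]; [simpl; lra|].
  rewrite S_INR. simpl. generalize (a_sub n (q * n)); lra.
Qed.

Lemma subadditive_limit_le (l : R) :
  a O <= 0 -> Un_cv (fun n => a n / INR n) l -> forall n, l * INR n <= a n \/ n = O.
Proof.
  intros H0 Hl n. destruct n as [|n]; [now right|left].
  set (N := S n). assert (HN : 0 < INR N) by (apply lt_0_INR; unfold N; lia).
  apply Rnot_lt_le; intro Hc.
  set (eps := l - a N / INR N).
  assert (He : 0 < eps).
  { unfold eps. assert (a N / INR N < l); [|lra].
    apply Rmult_lt_reg_r with (INR N); [easy|]. field_simplify; lra. }
  destruct (Hl eps He) as [n0 Hn0].
  specialize (Hn0 (S n0 * N)%nat).
  assert (Hge : (S n0 * N >= n0)%nat) by (unfold N; nia).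
  specialize (Hn0 Hge). unfold R_dist in Hn0.
  assert (Hb := subadditive_mul N (S n0) H0).
  assert (Hq : 0 < INR (S n0)) by (apply lt_0_INR; lia).
  assert (Hd : a (S n0 * N)%nat / INR (S n0 * N) <= a N / INR N).
  { rewrite mult_INR. apply Rmult_le_reg_r with (INR (S n0) * INR N).
    - now apply Rmult_lt_0_compat.
    - unfold Rdiv. replace (a N * / INR N * (INR (S n0) * INR N)) with (INR (S n0) * a N) by (field; lra).
      replace (a (S n0 * N)%nat * / (INR (S n0) * INR N) * (INR (S n0) * INR N)) with (a (S n0 * N)%nat)
        by (field; lra). exact Hb. }
  apply Rabs_def2 in Hn0. unfold eps in Hn0. lra.
Qed.

(** The limit is the infimum of [a n / n], taken as minus a supremum so that [completeness] applies.
    The linear lower bound [k] survives in the limit; this is how positive translation lengths are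
    obtained. *)
Lemma fekete (k : R) :
  0 <= k -> (forall n, k * INR n <= a n) -> a O <= 0 ->
  exists l, k <= l /\ Un_cv (fun n => a n / INR n) l.
Proof.
  intros Hk0 Hk H0.
  set (E := fun r => exists n, r = - (a (S n) / INR (S n))).
  assert (Hlow : forall n, k <= a (S n) / INR (S n)).
  { intro n. apply Rmult_le_reg_r with (INR (S n)); [apply lt_0_INR; lia|].
    generalize (Hk (S n)) (lt_0_INR (S n) ltac:(lia)); intros. unfold Rdiv.
    rewrite Rmult_assoc, Rinv_l; lra. }
  destruct (completeness E) as [m [Hub Hleast]].
  - exists (- k). intros r [n ->]. generalize (Hlow n); lra.
  - exists (- (a 1%nat / INR 1)). now exists O.
  - assert (Hmk : m <= - k).
    { apply Hleast. intros r [n ->]. generalize (Hlow n); lra. }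
    exists (- m). split; [lra|].
    intros eps He.
    assert (Hex : exists n, a (S n) / INR (S n) < - m + eps / 2).
    { apply NNPP; intro Hno. assert (m <= m - eps / 2); [|lra].
      apply Hleast. intros r [n ->]. apply Rnot_lt_le; intro Hlt. apply Hno. exists n. lra. }
    destruct Hex as [n1 Hn1]. set (N := S n1) in *.
    destruct (bounded_prefix a N) as [B [HB0 HB]].
    destruct (archimed_nat (2 * (B + 1) / eps)) as [n0 Hn0].
    exists (S n0). intros n Hn. unfold R_dist.
    assert (Hnpos : 0 < INR n) by (apply lt_0_INR; lia).
    assert (HNpos : 0 < INR N) by (apply lt_0_INR; unfold N; lia).
    assert (Hmn : - m <= a n / INR n).
    { destruct n as [|n']; [lia|]. assert (- (a (S n') / INR (S n')) <= m); [|lra].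
      apply Hub. now exists n'. }
    assert (Hdm := Nat.div_mod_eq n N).
    assert (Hmod : (n mod N < N)%nat) by (apply Nat.mod_upper_bound; unfold N; lia).
    set (q := (n / N)%nat) in *. set (r := (n mod N)%nat) in *.
    assert (Han : a n <= INR q * a N + B).
    { rewrite Hdm at 1. rewrite (Nat.mul_comm N q).
      generalize (a_sub (q * N) r) (subadditive_mul N q H0) (HB r ltac:(lia)); lra. }
    assert (HqN : INR q * INR N <= INR n).
    { rewrite <- mult_INR. apply le_INR. lia. }
    assert (HBn : B + 1 <= eps / 2 * INR n).
    { assert (INR n0 <= INR n) by (apply le_INR; lia).
      assert (H1 : 2 * (B + 1) / eps <= INR n) by lra.
      apply Rmult_le_compat_r with (r := eps / 2) in H1; [|lra].
      replace (2 * (B + 1) / eps * (eps / 2)) with (B + 1) in H1 by (field; lra). lra. }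
    assert (HaN : a N = (a N / INR N) * INR N) by (field; lra).
    assert (HB2 : INR q * a N <= (- m + eps / 2) * INR n).
    { rewrite HaN. apply Rle_trans with (INR q * ((- m + eps / 2) * INR N)).
      - apply Rmult_le_compat_l; [apply pos_INR|]. apply Rmult_le_compat_r; lra.
      - replace (INR q * ((- m + eps / 2) * INR N)) with ((- m + eps / 2) * (INR q * INR N)) by ring.
        apply Rmult_le_compat_l; lra. }
    assert (a n / INR n < - m + eps).
    { apply Rmult_lt_reg_r with (INR n); [easy|].
      replace (a n / INR n * INR n) with (a n) by (field; lra). lra. }
    apply Rabs_def1; lra.
Qed.
End Subadditive.

(** * Isometric actions on hyperbolic spaces *)

Section HyperbolicAction.
Variables (X : Type) (d : X -> X -> R) (delta : R).
Hypothesis Hmet : is_metric X d.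
Hypothesis Hhyp : hyperbolic X d delta.
Variables (G : Type) (mul : G -> G -> G) (inv : G -> G) (e : G).
Hypothesis Hgrp : is_group G mul inv e.
Variable act : G -> X -> X.
Hypothesis Hact : isometric_action X d G mul e act.
Variable x0 : X.

Local Infix "**" := mul (at level 40, left associativity).
Local Notation "g • y" := (act g y) (at level 41, right associativity).
Local Notation pow := (gpow G mul e).
Local Notation gp := (gprod X d x0).
Local Notation lox := (loxodromic X d G mul e act x0).
Local Notation isWPD := (WPD X d G mul e act x0).

Definition len (g : G) : R := d x0 (g • x0).

Lemma delta_nonneg : 0 <= delta. Proof. apply Hhyp. Qed.
Lemma d_nonneg y z : 0 <= d y z. Proof. apply Hmet. Qed.
Lemma d_sym y z : d y z = d z y. Proof. apply Hmet. Qed.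
Lemma d_triangle y z w : d y w <= d y z + d z w. Proof. apply Hmet. Qed.
Lemma d_self y : d y y = 0. Proof. now apply Hmet. Qed.
Lemma mulA f g h : f ** (g ** h) = f ** g ** h. Proof. apply Hgrp. Qed.
Lemma mul1g g : e ** g = g. Proof. apply Hgrp. Qed.
Lemma mulg1 g : g ** e = g. Proof. apply Hgrp. Qed.
Lemma mulVg g : inv g ** g = e. Proof. apply Hgrp. Qed.
Lemma mulgV g : g ** inv g = e. Proof. apply Hgrp. Qed.
Lemma mulKg g h : inv g ** (g ** h) = h. Proof. now rewrite mulA, mulVg, mul1g. Qed.
Lemma mulKVg g h : g ** (inv g ** h) = h. Proof. now rewrite mulA, mulgV, mul1g. Qed.
Lemma mulgK g h : g ** h ** inv h = g. Proof. now rewrite <- mulA, mulgV, mulg1. Qed.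
Lemma mulgKV g h : g ** inv h ** h = g. Proof. now rewrite <- mulA, mulVg, mulg1. Qed.
Lemma mulg_inj g h k : g ** h = g ** k -> h = k.
Proof. intro H. now rewrite <- (mulKg g h), H, mulKg. Qed.
Lemma invK g : inv (inv g) = g.
Proof. apply (mulg_inj (inv g)). now rewrite mulgV, mulVg. Qed.
Lemma invM g h : inv (g ** h) = inv h ** inv g.
Proof. apply (mulg_inj (g ** h)). now rewrite mulgV, mulA, mulgK, mulgV. Qed.
Lemma inv1 : inv e = e.
Proof. apply (mulg_inj e). now rewrite mulgV, mul1g. Qed.

Lemma act1 y : e • y = y. Proof. apply Hact. Qed.
Lemma actM g h y : (g ** h) • y = g • h • y. Proof. apply Hact. Qed.
Lemma d_act g y z : d (g • y) (g • z) = d y z. Proof. apply Hact. Qed.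
Lemma actK g y : inv g • g • y = y. Proof. now rewrite <- actM, mulVg, act1. Qed.
Lemma actKV g y : g • inv g • y = y. Proof. now rewrite <- actM, mulgV, act1. Qed.
Lemma d_act_l g y z : d (g • y) z = d y (inv g • z).
Proof. now rewrite <- (d_act g y), actKV. Qed.
Lemma d_act_r g y z : d y (g • z) = d (inv g • y) z.
Proof. now rewrite d_act_l, invK. Qed.

Lemma len_nonneg g : 0 <= len g. Proof. apply d_nonneg. Qed.
Lemma len1 : len e = 0. Proof. unfold len. now rewrite act1, d_self. Qed.
Lemma lenV g : len (inv g) = len g.
Proof. unfold len. now rewrite d_act_r, invK, d_sym. Qed.
Lemma lenM g h : len (g ** h) <= len g + len h.
Proof. unfold len. rewrite actM, <- (d_act g x0 (h • x0)). apply d_triangle. Qed.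
Lemma d_orbit_lower y g : d y x0 - len g <= d y (g • x0).
Proof. unfold len. generalize (d_triangle y (g • x0) x0). rewrite (d_sym (g • x0)). lra. Qed.
Lemma d_orbit_upper y g : d y (g • x0) <= d y x0 + len g.
Proof. apply d_triangle. Qed.

Lemma gp_sym w y z : gprod X d w y z = gprod X d w z y.
Proof. unfold gprod. rewrite (d_sym y z). lra. Qed.
Lemma gp_act g w y z : gprod X d (g • w) (g • y) (g • z) = gprod X d w y z.
Proof. unfold gprod. now rewrite !d_act. Qed.
Lemma gp_le_l w y z : gprod X d w y z <= d w y.
Proof. unfold gprod. generalize (d_triangle w y z). lra. Qed.
Lemma gp_le_r w y z : gprod X d w y z <= d w z.
Proof. rewrite gp_sym. apply gp_le_l. Qed.
Lemma gp_change w y z z' : gprod X d w y z <= gprod X d w y z' + d z z'.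
Proof.
  unfold gprod. generalize (d_triangle w z' z) (d_triangle y z z').
  rewrite (d_sym z' z). lra.
Qed.
Lemma gp_change_l w y y' z : gprod X d w y z <= gprod X d w y' z + d y y'.
Proof. rewrite !(gp_sym w _ z). apply gp_change. Qed.
Lemma gp_change_base w w' y z : gprod X d w y z <= gprod X d w' y z + d w w'.
Proof.
  unfold gprod. generalize (d_triangle w w' z) (d_triangle w w' y). lra.
Qed.

Lemma hyp_or w y z t :
  gprod X d w y z <= gprod X d w y t + delta \/ gprod X d w z t <= gprod X d w y t + delta.
Proof.
  destruct Hhyp as [_ H]. specialize (H w y z t). revert H. unfold Rmin.
  destruct (Rle_dec _ _); intros; [left|right]; lra.
Qed.

Lemma four_point y z w t :
  d y w + d z t <= d y z + d w t + 2 * delta \/ d y w + d z t <= d y t + d z w + 2 * delta.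
Proof.
  destruct (hyp_or y z w t) as [H|H]; unfold gprod in H; [right|left]; lra.
Qed.

Lemma powD g m n : pow g (m + n) = pow g m ** pow g n.
Proof. induction m as [|m IH]; simpl; [now rewrite mul1g|]. now rewrite IH, mulA. Qed.
Lemma powS g n : pow g (S n) = pow g n ** g.
Proof. rewrite <- Nat.add_1_r, powD. simpl. now rewrite mulg1. Qed.
Lemma pow_inv g n : pow (inv g) n = inv (pow g n).
Proof.
  induction n as [|n IH]; simpl; [now rewrite inv1|].
  change (g ** pow g n) with (pow g (S n)). now rewrite IH, <- invM, powS.
Qed.
Lemma len_pow_inv g n : len (pow (inv g) n) = len (pow g n).
Proof. now rewrite pow_inv, lenV. Qed.
Lemma d_pow g i n : d (pow g i • x0) (pow g (i + n) • x0) = len (pow g n).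
Proof. unfold len. now rewrite powD, actM, d_act. Qed.

Lemma lox_inv g : lox g -> lox (inv g).
Proof.
  intros [l [Hl H]]. exists l; split; [easy|].
  intros eps He. destruct (H eps He) as [N HN]. exists N. intros n Hn. specialize (HN n Hn).
  generalize (len_pow_inv g n). unfold len. intros ->. exact HN.
Qed.

(* With p n = |g^n| - l n, the four point condition for 1, g^n, g^(n+k), g^(2n+k) says that
   p either increases from n+k to n or almost doubles from n+k to 2n+k; repeated doubling
   contradicts p n = o(n). *)
Lemma lox_length g :
  lox g -> exists l C, 0 < l /\ 0 <= C /\ forall n, l * INR n <= len (pow g n) <= l * INR n + C.
Proof.
  intros [l [Hl Hcv]]. change (Un_cv (fun n => len (pow g n) / INR n) l) in Hcv.
  set (a := fun n => len (pow g n)) in *.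
  assert (Hsub : forall m n, a (m + n)%nat <= a m + a n).
  { intros m n. unfold a. rewrite powD. apply lenM. }
  assert (Ha0 : a O = 0) by apply len1.
  assert (Hlow : forall n, l * INR n <= a n).
  { intro n. destruct (subadditive_limit_le a Hsub l ltac:(lra) Hcv n) as [H| ->]; [easy|].
    simpl; lra. }
  assert (Hd0 := delta_nonneg).
  destruct (archimed_nat (delta / l)) as [k0 Hk0]. set (k := S k0).
  assert (Hk : delta <= l * INR k).
  { unfold k; rewrite S_INR. apply Rmult_le_compat_l with (r := l) in Hk0; [|lra].
    replace (l * (delta / l)) with delta in Hk0 by (field; lra). lra. }
  set (p := fun n => a n - l * INR n).
  assert (Hp0 : forall n, 0 <= p n) by (intro n; unfold p; generalize (Hlow n); lra).
  destruct (bounded_prefix p k) as [Q [HQ0 HQ]].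
  assert (Hdouble : forall N, Q < p N -> exists N', (N' <= 2 * N)%nat /\ 2 * p N - Q - 2 * delta <= p N').
  { induction N as [N IH] using lt_wf_ind. intro HN.
    assert (HkN : (k < N)%nat).
    { apply Nat.nle_gt. intro Hc. generalize (HQ N Hc). lra. }
    set (n := (N - k)%nat). assert (HN' : N = (n + k)%nat) by (unfold n; lia).
    assert (H4 := four_point x0 (pow g n • x0) (pow g (n + k) • x0) (pow g (n + k + n) • x0)).
    rewrite !d_pow in H4. replace (n + k + n)%nat with (n + (k + n))%nat in H4 at 1 by lia.
    replace (n + k + n)%nat with (n + (n + k))%nat in H4 by lia.
    rewrite !d_pow in H4. fold (len (pow g (n + k))) (len (pow g n)) (len (pow g (n + (n + k)))) in H4.
    rewrite (Nat.add_comm k n) in H4.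
    change (a (n + k)%nat + a (n + k)%nat <= a n + a n + 2 * delta \/
            a (n + k)%nat + a (n + k)%nat <= a (n + (n + k))%nat + a k + 2 * delta) in H4.
    destruct H4 as [H4|H4].
    - assert (Hpn : p N <= p n).
      { unfold p. rewrite HN', plus_INR. lra. }
      destruct (IH n ltac:(unfold n, k; lia) ltac:(lra)) as [N' [H1 H2]].
      exists N'. split; [lia|lra].
    - exists (n + (n + k))%nat. split; [lia|].
      generalize (HQ k (le_n k)). unfold p. rewrite HN', !plus_INR. lra. }
  exists l, (Q + 2 * delta + 1). split; [easy|split; [lra|]]. intro N. split; [apply Hlow|].
  apply Rnot_lt_le; intro Hbig. change (l * INR N + (Q + 2 * delta + 1) < a N) in Hbig.
  assert (HpN : Q + 2 * delta + 1 < p N) by (unfold p; lra).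
  assert (Hiter : forall j, exists N', INR N' <= 2 ^ j * INR N /\ Q + 2 * delta + 2 ^ j <= p N').
  { induction j as [|j [N1 [H1 H2]]].
    - exists N. simpl. split; lra.
    - assert (1 <= 2 ^ j) by (apply pow_R1_Rle; lra).
      destruct (Hdouble N1 ltac:(lra)) as [N2 [H3 H4]].
      exists N2. apply le_INR in H3. rewrite mult_INR in H3. simpl in *. split; lra. }
  assert (HN0 : 0 < INR N).
  { apply lt_0_INR. destruct N; [|lia]. unfold p in HpN. rewrite Ha0 in HpN. simpl in HpN. lra. }
  destruct (Hcv (/ (2 * INR N))) as [n0 Hn0]; [apply Rinv_0_lt_compat; lra|].
  destruct (bounded_prefix p n0) as [B [HB0 HB]].
  assert (Hlin : forall n, p n <= B + INR n / (2 * INR N)).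
  { intro n. assert (0 <= INR n / (2 * INR N)).
    { apply Rmult_le_pos; [apply pos_INR|]. left; apply Rinv_0_lt_compat; lra. }
    destruct (le_lt_dec n n0) as [Hn|Hn]; [generalize (HB n Hn); lra|].
    specialize (Hn0 n ltac:(lia)). unfold R_dist in Hn0. apply Rabs_def2 in Hn0. change (len (pow g n)) with (a n) in Hn0.
    assert (0 < INR n) by (apply lt_0_INR; lia).
    assert (Hq : a n / INR n <= l + / (2 * INR N)) by lra.
    apply Rmult_le_compat_r with (r := INR n) in Hq; [|lra].
    replace (a n / INR n * INR n) with (a n) in Hq by (field; lra).
    unfold p, Rdiv. lra. }
  destruct (pow2_unbounded (2 * B)) as [j Hj].
  destruct (Hiter j) as [N' [H1 H2]]. specialize (Hlin N').
  assert (INR N' / (2 * INR N) <= 2 ^ j / 2).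
  { apply Rmult_le_reg_r with (2 * INR N); [lra|].
    replace (INR N' / (2 * INR N) * (2 * INR N)) with (INR N') by (field; lra). lra. }
  lra.
Qed.

Lemma gp_inv_mul g h : gp (inv g • x0) (h • x0) = (len g + len h - len (g ** h)) / 2.
Proof.
  unfold gprod, len. rewrite actM, d_act_l, invK. now rewrite d_act_r, invK, (d_sym (g • x0)).
Qed.

Lemma gp_orbit g h : gp (g • x0) (h • x0) = (len g + len h - len (inv g ** h)) / 2.
Proof. now rewrite <- (invK g) at 1; rewrite gp_inv_mul, lenV. Qed.

(** The products of [h • x0] with one endpoint of the segment from [x0] to [g • x0], seen from the
    other endpoint, add up to the length of the segment; the second one is translated back to
    [x0]. *)
Lemma gp_swap g h : gp (g • x0) (h • x0) = len g - gp (inv g • x0) ((inv g ** h) • x0).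
Proof. rewrite gp_inv_mul, gp_orbit, mulKVg. lra. Qed.

(** By [lox_length] the length of powers is additive up to a constant, which bounds the backtracking
    of the orbit at [x0]. *)
Lemma lox_opposite g :
  lox g -> exists C, 0 <= C /\ forall i j, gp (inv (pow g i) • x0) (pow g j • x0) <= C.
Proof.
  intro H. destruct (lox_length g H) as [l [C [Hl [HC HN]]]].
  exists C. split; [easy|]. intros i j. rewrite gp_inv_mul, <- powD.
  generalize (HN i) (HN j) (HN (i + j)%nat). rewrite plus_INR. lra.
Qed.

(** Distinct boundary points only provide arbitrarily late pairs with product below some [M]. A
    large product at one pair would persist: later orbit points lie behind earlier ones by
    [lox_opposite], so hyperbolicity would give product at least [M] for all later pairs. *)
Lemma lox_separated g h :
  lox g -> lox h ->
  ~ same_boundary_point X d x0 (fun n => pow g n • x0) (fun n => pow h n • x0) ->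
  exists C, 0 <= C /\ forall i j, gp (pow g i • x0) (pow h j • x0) <= C.
Proof.
  intros Hg Hh Hns.
  destruct (lox_opposite g Hg) as [C1 [HC1 H1]]. destruct (lox_opposite h Hh) as [C2 [HC2 H2]].
  apply not_all_ex_not in Hns. destruct Hns as [M HM].
  assert (Hd0 := delta_nonneg).
  exists (Rmax 0 M + C1 + C2 + 2 * delta). split; [generalize (Rmax_l 0 M); lra|].
  intros i j. generalize (Rmax_r 0 M) (Rmax_l 0 M). intros HM0 HM1.
  apply NNPP; intro Hc. apply HM. exists (Nat.max i j). intros i' j' Hi Hj.
  assert (Hnear : forall u C n n', (forall i j, gp (inv (pow u i) • x0) (pow u j • x0) <= C) ->
            (n <= n')%nat -> len (pow u n) - C <= gp (pow u n • x0) (pow u n' • x0)).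
  { intros u C n n' HC Hn. rewrite gp_swap. replace n' with (n + (n' - n))%nat by lia.
    rewrite powD, mulKg. generalize (HC n (n' - n)%nat). lra. }
  assert (Ha := Hnear g C1 i i' H1 ltac:(lia)). assert (Hb := Hnear h C2 j j' H2 ltac:(lia)).
  assert (Hia := gp_le_l x0 (pow g i • x0) (pow h j • x0)).
  assert (Hjb := gp_le_r x0 (pow g i • x0) (pow h j • x0)).
  fold (len (pow g i)) in Hia. fold (len (pow h j)) in Hjb.
  destruct (hyp_or x0 (pow g i' • x0) (pow g i • x0) (pow h j' • x0)) as [E|E];
    [rewrite gp_sym in E; lra|].
  destruct (hyp_or x0 (pow g i • x0) (pow h j • x0) (pow h j' • x0)) as [E'|E']; lra.
Qed.

(** * Ping-pong pairs and chains *)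

(** All six products between the attracting directions of [a], [b] and their repelling directions
    [inv a], [inv b]. Only the size of [m] relative to [c] matters, so pairs are later produced with
    [c] fixed and [m] arbitrary. *)
Definition pingpong (c m : R) (a b : G) : Prop :=
  gp (a • x0) (b • x0) <= c /\ gp (inv a • x0) (inv b • x0) <= c /\
  gp (a • x0) (inv a • x0) <= c /\ gp (a • x0) (inv b • x0) <= c /\
  gp (b • x0) (inv a • x0) <= c /\ gp (b • x0) (inv b • x0) <= c /\
  m <= len a /\ m <= len b.

Lemma pingpong_sym c m a b : pingpong c m a b -> pingpong c m b a.
Proof.
  intros (H1 & H2 & H3 & H4 & H5 & H6 & H7 & H8).
  unfold pingpong. rewrite (gp_sym _ (b • x0) (a • x0)), (gp_sym _ (inv b • x0) (inv a • x0)).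
  tauto.
Qed.

(** The ping-pong domain: for long letters it is mapped into itself by both [a] and [b]. *)
Definition clear_of_repellers (c : R) (a b : G) (z : X) : Prop :=
  gp z (inv a • x0) <= c + delta /\ gp z (inv b • x0) <= c + delta.

Lemma clear_of_repellers_sym c a b z : clear_of_repellers c a b z -> clear_of_repellers c b a z.
Proof. unfold clear_of_repellers; tauto. Qed.

Lemma one_repeller c m a b z :
  pingpong c m a b -> gp z (inv a • x0) <= c + delta \/ gp z (inv b • x0) <= c + delta.
Proof.
  intros (_ & H & _). destruct (hyp_or x0 (inv a • x0) z (inv b • x0)) as [E|E].
  - left. rewrite gp_sym. lra.
  - right. lra.
Qed.

(** The two products add up to exactly [len u]. *)
Lemma attract u z c : gp z (inv u • x0) <= c -> len u - c <= gp (u • z) (u • x0).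
Proof.
  unfold gprod, len. rewrite d_act, (d_act_r (inv u) z), (d_act_r (inv u) x0), invK.
  rewrite (d_sym (u • z) x0), (d_sym z x0), (d_sym (u • x0) x0). lra.
Qed.

Lemma clear_after_letter c m a b z :
  2 * c + 2 * delta < m -> pingpong c m a b -> gp z (inv a • x0) <= c + delta ->
  clear_of_repellers c a b (a • z).
Proof.
  intros Hm (H1 & H2 & H3 & H4 & H5 & H6 & H7 & H8) Hz.
  assert (Ha := attract _ _ _ Hz). rewrite gp_sym in Ha. split.
  - destruct (hyp_or x0 (a • x0) (a • z) (inv a • x0)) as [E|E]; lra.
  - destruct (hyp_or x0 (a • x0) (a • z) (inv b • x0)) as [E|E]; lra.
Qed.

(** [a • z] and [b • z'] are drawn towards separated directions, so [y] cannot be close to both. The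
    letter depends on [y] alone and serves all [z], hence all continuations of a word at once. *)
Lemma one_attractor c m a b y :
  2 * c + 4 * delta < m -> pingpong c m a b ->
  (forall z, clear_of_repellers c a b z -> gp y (a • z) <= c + 3 * delta) \/
  (forall z, clear_of_repellers c a b z -> gp y (b • z) <= c + 3 * delta).
Proof.
  intros Hm (H1 & H2 & H3 & H4 & H5 & H6 & H7 & H8).
  assert (Hd := delta_nonneg). apply NNPP; intro Hc.
  apply not_or_and in Hc. destruct Hc as [Ha Hb].
  apply not_all_ex_not in Ha, Hb. destruct Ha as [z Ha], Hb as [z' Hb].
  apply imply_to_and in Ha, Hb. destruct Ha as [[Hz _] Ha], Hb as [[_ Hz'] Hb].
  apply attract in Hz, Hz'. rewrite gp_sym in Hz. rewrite gp_sym in Ha.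
  destruct (hyp_or x0 (a • z) y (b • z')) as [E|E];
  destruct (hyp_or x0 (a • x0) (a • z) (b • z')) as [E'|E'];
  destruct (hyp_or x0 (a • x0) (b • z') (b • x0)) as [E''|E'']; lra.
Qed.

Definition two_letter_words (a b : G) : list G := (a ** a :: a ** b :: b ** a :: b ** b :: nil)%list.

(** The right letter is chosen for [z], to clear it of the repellers; the left letter is then chosen
    for [y]. *)
Lemma two_letter_word_spec c m a b y z :
  2 * c + 4 * delta < m -> pingpong c m a b ->
  exists u, In u (two_letter_words a b) /\
    gp y (u • z) <= c + 3 * delta /\ m - c - delta <= d x0 (u • z).
Proof.
  intros Hm Hp. assert (Hd := delta_nonneg).
  assert (Hl : exists l, (l = a \/ l = b) /\ clear_of_repellers c a b (l • z)).
  { destruct (one_repeller c m a b z Hp) as [H|H].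
    - exists a; split; [tauto|]. apply clear_after_letter with m; auto; lra.
    - exists b; split; [tauto|]. apply clear_of_repellers_sym.
      apply clear_after_letter with m; [lra|now apply pingpong_sym|easy]. }
  destruct Hl as [l [Hl Hc]].
  assert (Hk : exists k, (k = a \/ k = b) /\ gp y (k • l • z) <= c + 3 * delta /\
                gp (l • z) (inv k • x0) <= c + delta /\ m <= len k).
  { destruct Hp as (H1 & H2 & H3 & H4 & H5 & H6 & H7 & H8).
    destruct (one_attractor c m a b y Hm ltac:(repeat split; assumption)) as [H|H];
    [exists a|exists b]; (split; [tauto|split; [now apply H|split; [apply Hc|easy]]]). }
  destruct Hk as [k (Hk & H1 & H2 & H3)].
  exists (k ** l). rewrite actM. split; [|split; [easy|]].
  - unfold two_letter_words; simpl. destruct Hk as [->| ->], Hl as [->| ->]; tauto.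
  - apply attract in H2. generalize (gp_le_l x0 (k • l • z) (k • x0)). lra.
Qed.

(** The local-to-global step. Here [w] is a product whose path starts along [v]; as [v] is long and
    turns away from [inv u], so does [w], and [u ** w] in turn starts along [u]. Iterating it from
    right to left controls products of any number of factors. *)
Lemma link_step r u v w :
  gp (inv u • x0) (v • x0) <= r -> 2 * r + 2 * delta < len v ->
  len v - r - delta <= gp (v • x0) (w • x0) ->
  gp (inv u • x0) (w • x0) <= r + delta /\
  len u - r - delta <= gp (u • x0) ((u ** w) • x0).
Proof.
  intros H1 H2 H3.
  assert (H : gp (inv u • x0) (w • x0) <= r + delta).
  { destruct (hyp_or x0 (inv u • x0) (w • x0) (v • x0)) as [E|E]; [lra|].
    rewrite gp_sym in E. lra. }
  split; [easy|]. rewrite gp_swap, mulKg. lra.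
Qed.

Fixpoint linked (r m : R) (u : G) (l : list G) : Prop :=
  match l with
  | nil => True
  | v :: l' => gp (inv u • x0) (v • x0) <= r /\ m <= len v /\ linked r m v l'
  end.

Definition lprod (l : list G) : G := fold_right mul e l.

Lemma lprod_app l l' : lprod (l ++ l') = lprod l ** lprod l'.
Proof. induction l as [|u l IH]; simpl; [now rewrite mul1g|]. now rewrite IH, mulA. Qed.

Lemma linked_app r m u l v l' :
  linked r m u (l ++ v :: l') <->
  linked r m u l /\ gp (inv (last l u) • x0) (v • x0) <= r /\ m <= len v /\ linked r m v l'.
Proof.
  revert u; induction l as [|w l IH]; intro u; simpl; [tauto|].
  rewrite (IH w). destruct l as [|w' l]; [simpl; tauto|].
  replace (last (w' :: l) u) with (last (w' :: l) w); [tauto|].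
  clear. revert w'. induction l as [|w'' l IH]; intro w'; [easy|]. apply (IH w'').
Qed.

Lemma gp_self g : gp (g • x0) (g • x0) = len g.
Proof. unfold gprod, len. rewrite d_self. lra. Qed.

Lemma linked_prod_first r m u l :
  0 <= r -> 2 * r + 2 * delta < m -> linked r m u l ->
  len u - r - delta <= gp (u • x0) ((u ** lprod l) • x0).
Proof.
  intros Hr Hm. revert u. assert (Hd := delta_nonneg).
  induction l as [|v l IH]; intros u Hl; simpl in *.
  - rewrite mulg1, gp_self. lra.
  - destruct Hl as (H1 & H2 & H3). apply link_step with v; [easy|lra|now apply IH].
Qed.

(** The mirror image of [linked_prod_first]: inversion reverses the word, so the induction adds
    factors on the right. *)
Lemma linked_prod_last r m u l :
  0 <= r -> 2 * r + 2 * delta < m -> m <= len u -> linked r m u l ->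
  m <= len (last l u) /\
  len (last l u) - r - delta <= gp (inv (last l u) • x0) (inv (u ** lprod l) • x0).
Proof.
  intros Hr Hm Hu. assert (Hd := delta_nonneg).
  induction l as [|v l IH] using rev_ind; intro Hl; simpl in *.
  - rewrite mulg1, gp_self, lenV. lra.
  - apply linked_app in Hl. destruct Hl as (H1 & H2 & H3 & _).
    destruct (IH H1) as [H4 H5]. rewrite last_last. split; [easy|].
    rewrite lprod_app. simpl. rewrite mulg1, mulA, (invM _ v), <- (lenV v).
    apply (link_step r (inv v) (inv (last l u))).
    + now rewrite invK, gp_sym.
    + rewrite lenV. lra.
    + rewrite lenV. exact H5.
Qed.

(** * A criterion for WPD *)

Lemma finite_subset (P Q : G -> Prop) :
  (forall g, P g -> Q g) -> finite_set G Q -> finite_set G P.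
Proof. intros H [l Hl]. exists l. auto. Qed.

Lemma finite_image (P Q : G -> Prop) (f : G -> G) :
  (forall g, P g -> exists k, Q k /\ g = f k) -> finite_set G Q -> finite_set G P.
Proof.
  intros H [l Hl]. exists (map f l). intros g Hg. destruct (H g Hg) as [k [Hk ->]].
  apply in_map. auto.
Qed.

Lemma finite_of_differences (P Q : G -> Prop) :
  finite_set G Q -> (forall g h, P g -> P h -> Q (inv g ** h)) -> finite_set G P.
Proof.
  intros HQ H. destruct (classic (exists g, P g)) as [[g Hg]|Hno].
  - apply finite_image with Q (fun k => g ** k); [|easy].
    intros h Hh. exists (inv g ** h). rewrite mulKVg. auto.
  - exists nil. intros g Hg. elim Hno. now exists g.
Qed.

(** Reduces finiteness of a coarse stabiliser to elements whose translation amounts [phi] agree up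
    to 1. *)
Lemma finite_slices (P : G -> Prop) (phi : G -> R) (B : R) :
  (forall g, P g -> 0 <= phi g <= B) ->
  (forall t, finite_set G (fun g => P g /\ t <= phi g <= t + 1)) ->
  finite_set G P.
Proof.
  intros HB Hsl. destruct (archimed_nat B) as [n Hn].
  assert (H : forall n, finite_set G (fun g => P g /\ phi g <= INR n)).
  { clear n Hn. induction n as [|n [l Hl]].
    - apply finite_subset with (2 := Hsl 0). intros g [Hg H]. split; [easy|].
      generalize (HB g Hg). simpl in H. lra.
    - destruct (Hsl (INR n)) as [l' Hl']. exists (l ++ l')%list. intros g [Hg H].
      rewrite S_INR in H. apply in_or_app.
      destruct (Rle_or_lt (phi g) (INR n)); [left; auto|right; apply Hl'; split; [easy|lra]]. }
  apply finite_subset with (2 := H n). intros g Hg. generalize (HB g Hg). split; [easy|lra].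
Qed.

(** The displacement [k] of the endpoints is absent from the conclusion: a point deep inside stays
    near the geodesic with a constant depending only on [c] and [delta]. This is the reason why one
    coarse stabiliser serves every constant in the definition of WPD. *)
Lemma act_near_geodesic u y z q c k :
  gprod X d q y z <= c -> d y (u • y) <= k -> d z (u • z) <= k ->
  k + c + 2 * delta < d y q -> k + c + 2 * delta < d z q ->
  gprod X d (u • q) y z <= c + 2 * delta.
Proof.
  intros Hq Hy Hz Hyq Hzq. assert (Hd := delta_nonneg).
  rewrite <- (gp_act u q y z) in Hq.
  assert (H : forall p, d (u • q) (u • p) - d p (u • p) <= gprod X d (u • q) (u • p) p).
  { intro p. unfold gprod. generalize (d_triangle (u • q) p (u • p)). rewrite (d_sym (u • p) p). lra. }
  assert (H1 := H y). assert (H2 := H z). rewrite d_act in H1, H2.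
  rewrite (d_sym q) in H1, H2.
  destruct (hyp_or (u • q) (u • y) y (u • z)) as [E|E]; [lra|].
  destruct (hyp_or (u • q) y z (u • z)) as [E'|E']; [lra|].
  rewrite gp_sym in H2. lra.
Qed.

Lemma close_on_geodesic y z p q c :
  gprod X d p y z <= c -> gprod X d q y z <= c ->
  d y q - 1 <= d y p <= d y q + 1 -> d p q <= 2 * c + 1 + 2 * delta.
Proof.
  unfold gprod. intros Hp Hq Hpq.
  rewrite (d_sym p y) in Hp. rewrite (d_sym q y) in Hq.
  destruct (four_point p y q z) as [E|E]; rewrite ?(d_sym p y) in E; lra.
Qed.

Lemma displacement_on_geodesic u y z q c k :
  gprod X d q y z <= c -> d y (u • y) <= k -> d z (u • z) <= k ->
  d q (u • q) <= 2 * c + k + 2 * delta.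
Proof.
  unfold gprod. intros Hq Hy Hz.
  assert (H1 := d_triangle y (u • y) (u • q)). assert (H2 := d_triangle z (u • z) (u • q)).
  rewrite d_act in H1, H2. rewrite (d_sym q y), (d_sym q z) in Hq.
  destruct (four_point q y (u • q) z) as [E|E]; rewrite (d_sym q) in E;
    rewrite ?(d_sym q z), ?(d_sym (u • q) z), ?(d_sym q y) in E; rewrite ?(d_sym (u • q) q) in *; lra.
Qed.

Lemma Stab_base k y z g : Stab X d G act k y (g • y) z ->
  Stab X d G act (k + 2 * d x0 y) x0 (g • x0) z.
Proof.
  intros [H1 H2].
  assert (Hg : forall p q, d q (z • q) <= d q p + d p (z • p) + d p q).
  { intros p q. generalize (d_triangle q p (z • q)) (d_triangle p (z • p) (z • q)).
    rewrite d_act. lra. }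
  split.
  - generalize (Hg y x0). rewrite (d_sym y x0). lra.
  - generalize (Hg (g • y) (g • x0)). rewrite !d_act, (d_sym y x0). lra.
Qed.

Lemma pow_conj k g n : pow (k ** g ** inv k) n = k ** pow g n ** inv k.
Proof.
  induction n as [|n IH]; simpl; [now rewrite mulg1, mulgV|].
  now rewrite IH, !mulA, mulgKV.
Qed.

Lemma lox_conj k g : lox g -> lox (k ** g ** inv k).
Proof.
  intros [l [Hl H]]. exists l; split; [easy|]. intros eps He.
  destruct (H (eps / 2) ltac:(lra)) as [n0 Hn0].
  destruct (archimed_nat (4 * (len k + 1) / eps)) as [n1 Hn1].
  exists (S (n0 + n1)). intros n Hn. specialize (Hn0 n ltac:(lia)).
  unfold R_dist in *. rewrite pow_conj.
  change (d x0 (pow g n • x0)) with (len (pow g n)) in Hn0.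
  change (d x0 ((k ** pow g n ** inv k) • x0)) with (len (k ** pow g n ** inv k)).
  assert (Hn' : 0 < INR n) by (apply lt_0_INR; lia).
  assert (H1 : INR n1 <= INR n) by (apply le_INR; lia).
  assert (Hk := len_nonneg k).
  assert (H2 : 4 * (len k + 1) <= eps * INR n).
  { assert (H3 : 4 * (len k + 1) / eps <= INR n) by lra.
    apply Rmult_le_compat_l with (r := eps) in H3; [|lra].
    replace (eps * (4 * (len k + 1) / eps)) with (4 * (len k + 1)) in H3 by (field; lra). lra. }
  assert (Ha : len (k ** pow g n ** inv k) <= len (pow g n) + 2 * len k).
  { generalize (lenM (k ** pow g n) (inv k)) (lenM k (pow g n)). rewrite lenV. lra. }
  assert (Hb : len (pow g n) <= len (k ** pow g n ** inv k) + 2 * len k).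
  { generalize (lenM (inv k) (k ** pow g n ** inv k ** k)) (lenM (k ** pow g n ** inv k) k).
    rewrite mulgKV, mulKg, lenV. lra. }
  set (A := len (pow g n)) in *. set (B := len (k ** pow g n ** inv k)) in *.
  assert (Hq : Rabs (B / INR n - A / INR n) < eps / 2).
  { replace (B / INR n - A / INR n) with ((B - A) / INR n) by (field; lra).
    unfold Rdiv. rewrite Rabs_mult, (Rabs_pos_eq (/ INR n));
      [|left; now apply Rinv_0_lt_compat].
    apply Rmult_lt_reg_r with (INR n); [easy|]. rewrite Rmult_assoc, Rinv_l, Rmult_1_r by lra.
    assert (Rabs (B - A) <= 2 * len k) by (apply Rabs_le; lra). lra. }
  replace (B / INR n - l) with ((B / INR n - A / INR n) + (A / INR n - l)) by ring.
  apply Rle_lt_trans with (1 := Rabs_triang _ _). lra.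
Qed.

Lemma WPD_conj k g : isWPD g -> isWPD (k ** g ** inv k).
Proof.
  intros [Hl H]. split; [now apply lox_conj|]. intros K y HK.
  destruct (H K (inv k • y) HK) as [M HM]. exists M.
  apply finite_image with (2 := HM) (f := fun u => k ** u ** inv k).
  intros u [H1 H2]. exists (inv k ** u ** k). split.
  - rewrite pow_conj in H2. rewrite !actM in H2. split.
    + now rewrite <- (d_act k), !actM, !actKV.
    + rewrite <- (d_act k), !actM, !actKV. exact H2.
  - now rewrite <- !mulA, mulgV, mulg1, mulKVg.
Qed.

(** The word f V f V ... satisfies the hypothesis of [link_step] at each junction. The two
    statements feed each other: the one for [f] follows from the one for [V] at the same exponent,
    the one for [V] from the one for [f] at the previous exponent. *)
Lemma concat_pow_near r f V n :
  gp (inv f • x0) (V • x0) <= r -> gp (inv V • x0) (f • x0) <= r -> 0 <= r ->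
  2 * r + 2 * delta < len f -> 2 * r + 2 * delta < len V ->
  len V - r - delta <= gp (V • x0) ((V ** pow (f ** V) n) • x0) /\
  len f - r - delta <= gp (f • x0) ((f ** V ** pow (f ** V) n) • x0).
Proof.
  intros H1 H2 Hr Hf HV. assert (Hd := delta_nonneg).
  assert (Hstep : forall w, len V - r - delta <= gp (V • x0) ((V ** w) • x0) ->
    len f - r - delta <= gp (f • x0) ((f ** V ** w) • x0)).
  { intros w Hw. rewrite <- mulA. now apply (link_step r f V (V ** w)). }
  induction n as [|n [IH1 IH2]].
  - assert (H0 : len V - r - delta <= gp (V • x0) ((V ** e) • x0)) by (rewrite mulg1, gp_self; lra).
    split; [easy|]. now apply Hstep.
  - assert (H0 : len V - r - delta <= gp (V • x0) ((V ** pow (f ** V) (S n)) • x0)).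
    { simpl. now apply (link_step r V f (f ** V ** pow (f ** V) n)). }
    split; [easy|]. now apply Hstep.
Qed.

(** Each junction cancels at most 2r + 2 delta, and each factor is longer than that by at least
    1. *)
Lemma concat_growth r f V n :
  gp (inv f • x0) (V • x0) <= r -> gp (inv V • x0) (f • x0) <= r -> 0 <= r ->
  2 * r + 2 * delta + 1 <= len f -> 2 * r + 2 * delta + 1 <= len V ->
  INR n <= len (pow (f ** V) n).
Proof.
  intros H1 H2 Hr Hf HV. assert (Hd := delta_nonneg).
  induction n as [|n IH]; [simpl; rewrite len1; lra|].
  assert (Hgp := gp_inv_mul f (V ** pow (f ** V) n)).
  assert (HVn : len (pow (f ** V) n) + len V - 2 * r - 2 * delta <= len (V ** pow (f ** V) n)).
  { destruct n as [|n]; [simpl; rewrite mulg1, len1; lra|].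
    assert (Hgp' := gp_inv_mul V (pow (f ** V) (S n))).
    destruct (link_step r V f (pow (f ** V) (S n))) as [E _]; [easy|lra| |lra].
    apply (concat_pow_near r f V n); auto; lra. }
  destruct (link_step r f V (V ** pow (f ** V) n)) as [E _]; [easy|lra| |].
  { apply (concat_pow_near r f V n); auto; lra. }
  rewrite S_INR. simpl. rewrite <- mulA. lra.
Qed.

(* Two elements of a coarse stabiliser of [x0, g^(2n) x0] which translate the two points
   g^n x0 and g^n f x0 by amounts equal up to 1 differ by an element moving these points a
   distance bounded independently of the size of the stabiliser. *)
Lemma concat_WPD r f V :
  gp (inv f • x0) (V • x0) <= r -> gp (inv V • x0) (f • x0) <= r -> 0 <= r ->
  2 * r + 3 * delta + 1 <= len f -> 2 * r + 3 * delta + 1 <= len V ->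
  finite_set G (Stab X d G act (2 * (r + 4 * delta) + 1 + 2 * delta) x0 (f • x0)) ->
  isWPD (f ** V).
Proof.
  intros H1 H2 Hr Hf HV Hfin. assert (Hd := delta_nonneg).
  set (g := f ** V) in *.
  assert (Hgrow : forall n, INR n <= len (pow g n)) by (intro n; apply concat_growth with r; auto; lra).
  split.
  { destruct (fekete (fun n => len (pow g n))) with (k := 1) as [l [Hl Hcv]].
    - intros m n. rewrite powD. apply lenM.
    - lra.
    - intro n. generalize (Hgrow n). lra.
    - simpl. rewrite len1. lra.
    - exists l. split; [lra|exact Hcv]. }
  intros K0 y HK0. set (K := K0 + 2 * d x0 y).
  (* [p] and [p'] then lie at distance at least |g^n| - |f| from both ends, deep enough for
     [act_near_geodesic] with displacement [K]. *)
  destruct (archimed_nat (K + r + 4 * delta + 1 + len f)) as [n0 Hn0].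
  set (n := S n0).
  assert (Hn : K + r + 4 * delta + 1 + len f < len (pow g n)).
  { generalize (Hgrow n). unfold n at 1. rewrite S_INR. lra. }
  exists (n + n)%nat.
  apply finite_subset with (Q := Stab X d G act K x0 (pow g (n + n) • x0));
    [intros u Hu; now apply Stab_base|].
  assert (HI1 : gp (inv (inv V) • x0) (inv f • x0) <= r) by now rewrite invK, gp_sym.
  assert (HI2 : gp (inv (inv f) • x0) (inv V • x0) <= r) by now rewrite invK, gp_sym.
  assert (Hinvpow : forall k, pow (inv V ** inv f) k = inv (pow g k)).
  { intro k. unfold g. now rewrite <- pow_inv, invM. }
  assert (Hprod : forall u v w w', gp (inv u • x0) (v • x0) <= r ->
    2 * r + 3 * delta + 1 <= len v -> 2 * r + 3 * delta + 1 <= len u ->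
    len u - r - delta <= gp (inv u • x0) (w • x0) ->
    len v - r - delta <= gp (v • x0) (w' • x0) ->
    gp (w • x0) (w' • x0) <= r + 2 * delta).
  { intros u v w w' E1 E2 E3 E4 E5.
    destruct (link_step r u v w') as [E _]; [easy|lra|easy|].
    destruct (hyp_or x0 (inv u • x0) (w • x0) (w' • x0)) as [E'|E']; lra. }
  set (p := pow g n • x0). set (p' := (pow g n ** f) • x0). set (z := pow g (n + n) • x0).
  assert (Hnear : forall k, len (inv f) - r - delta <= gp (inv f • x0) ((inv f ** pow (inv V ** inv f) k) • x0) /\
     len (inv V) - r - delta <= gp (inv V • x0) ((inv V ** inv f ** pow (inv V ** inv f) k) • x0)).
  { intro k. apply concat_pow_near; rewrite ?lenV; auto; lra. }
  assert (Hp : gprod X d p x0 z <= r + 2 * delta).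
  { unfold p, z. rewrite powD, <- (gp_act (inv (pow g n))), actK, actM, actK.
    rewrite <- Hinvpow. unfold n at 1 2. apply (Hprod V f); auto.
    - rewrite <- (lenV V). simpl. apply (Hnear n0).
    - apply (concat_pow_near r f V n0); auto; lra. }
  assert (Hp' : gprod X d p' x0 z <= r + 2 * delta).
  { unfold p', z. rewrite powD, <- (gp_act (inv (pow g n ** f))), actK, <- actM, invM.
    rewrite mulA, mulgKV, <- Hinvpow.
    replace (inv f ** pow g n) with (V ** pow g n0) by (unfold n; simpl; unfold g; now rewrite <- mulA, mulKg).
    apply (Hprod f V); auto.
    - rewrite <- (lenV f). apply (Hnear n).
    - apply (concat_pow_near r f V n0); auto; lra. }
  assert (Hxp : d x0 p = len (pow g n)) by reflexivity.
  assert (Hzp : d z p = len (pow g n)).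
  { unfold z, p. rewrite d_sym, d_pow. reflexivity. }
  assert (Hpp' : d p p' = len f) by (unfold p, p'; rewrite actM, d_act; reflexivity).
  assert (Hxp' := d_triangle x0 p' p). assert (Hzp' := d_triangle z p' p).
  rewrite (d_sym p' p) in Hxp', Hzp'. assert (Hlf := len_nonneg f).
  assert (Hmove : forall q u, d x0 (u • x0) <= K -> 0 <= d x0 (u • q) - d x0 q + K <= 2 * K).
  { intros q u Hu. generalize (d_triangle x0 (u • x0) (u • q)) (d_triangle (u • x0) x0 (u • q)).
    rewrite d_act, (d_sym (u • x0) x0). lra. }
  assert (Hclose : forall q u v t, Stab X d G act K x0 z u -> Stab X d G act K x0 z v ->
    gprod X d q x0 z <= r + 2 * delta -> K + (r + 2 * delta) + 2 * delta < d x0 q ->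
    K + (r + 2 * delta) + 2 * delta < d z q ->
    t <= d x0 (u • q) - d x0 q + K <= t + 1 -> t <= d x0 (v • q) - d x0 q + K <= t + 1 ->
    d q ((inv u ** v) • q) <= 2 * (r + 4 * delta) + 1 + 2 * delta).
  { intros q u v t [Hu1 Hu2] [Hv1 Hv2] Hq Hxq Hzq Hu Hv. rewrite actM, d_act_r, invK.
    apply close_on_geodesic with x0 z; [| |lra].
    - replace (r + 4 * delta) with (r + 2 * delta + 2 * delta) by ring.
      now apply act_near_geodesic with K.
    - replace (r + 4 * delta) with (r + 2 * delta + 2 * delta) by ring.
      now apply act_near_geodesic with K. }
  apply finite_slices with (phi := fun u => d x0 (u • p) - d x0 p + K) (B := 2 * K);
    [intros u [Hu _]; now apply Hmove|]. intro t.
  apply finite_slices with (phi := fun u => d x0 (u • p') - d x0 p' + K) (B := 2 * K);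
    [intros u [[Hu _] _]; now apply Hmove|]. intro t'.
  apply finite_of_differences with
    (Q := Stab X d G act (2 * (r + 4 * delta) + 1 + 2 * delta) p p').
  - apply finite_image with (2 := Hfin) (f := fun u => pow g n ** u ** inv (pow g n)).
    intros u [Hu1 Hu2]. exists (inv (pow g n) ** u ** pow g n). split.
    + unfold p, p' in Hu1, Hu2. rewrite actM in Hu2. now split; rewrite !actM, d_act_r, invK.
    + now rewrite <- !mulA, mulgV, mulg1, mulKVg.
  - intros u v [[Hu Hut] Hut'] [[Hv Hvt] Hvt']. split.
    + apply Hclose with t; auto; lra.
    + apply Hclose with t'; auto; lra.
Qed.

(** WPD supplies a single exponent, while later a power is needed that is long as well. An element
    moving both ends of a longer orbit segment by at most [k] moves the orbit point at exponent [M0]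
    by at most 2C + k + 2 delta, so WPD is invoked with that larger constant. *)
Lemma WPD_power_finite h k :
  isWPD h -> 0 < k -> exists M0, forall M, (M0 <= M)%nat ->
    finite_set G (Stab X d G act k x0 (pow h M • x0)).
Proof.
  intros [Hl H] Hk. destruct (lox_opposite h Hl) as [C [HC Hopp]].
  assert (Hd := delta_nonneg).
  destruct (H (2 * C + k + 2 * delta) x0 ltac:(lra)) as [M0 HM0].
  exists M0. intros M HM. apply finite_subset with (2 := HM0). intros u [Hu1 Hu2]. split; [lra|].
  apply displacement_on_geodesic with x0 (pow h M • x0); [|easy|easy].
  replace M with (M0 + (M - M0))%nat by lia. rewrite powD.
  rewrite <- (gp_act (inv (pow h M0))), actK, actM, actK. apply Hopp.
Qed.

(** * The random walk *)

Section Walk.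
Variables (s : nat -> G) (p : nat -> R) (C : R).
Hypothesis Hp0 : forall i, 0 <= p i.
Hypothesis Hp1 : infinite_sum p 1.
Hypothesis HsC : forall i, len (s i) <= C.

(** [Series] is total and says nothing about divergent series, so linearity and monotonicity below
    carry bounds on [F] to secure convergence. *)
Definition mean (F : nat -> R) : R := Series (fun i => p i * F i).

Lemma Hp1_series : is_series p 1.
Proof. now apply is_series_Reals. Qed.

Lemma mean_ex F M : (forall i, Rabs (F i) <= M) -> ex_series (fun i => p i * F i).
Proof.
  intro H. apply (ex_series_le (fun i => p i * F i) (fun i => M * p i)).
  - intro i. change (norm (p i * F i)) with (Rabs (p i * F i)).
    rewrite Rabs_mult, (Rabs_pos_eq (p i)), Rmult_comm by easy.
    now apply Rmult_le_compat_r.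
  - apply (ex_series_scal M p). exists 1. apply Hp1_series.
Qed.

Lemma mean_ext F F' : (forall i, F i = F' i) -> mean F = mean F'.
Proof. intro H. apply Series_ext. intro i. now rewrite H. Qed.

Lemma mean_const c : mean (fun _ => c) = c.
Proof.
  unfold mean. rewrite Series_scal_r, (is_series_unique p 1 Hp1_series). lra.
Qed.

Lemma mean_lin a b F F' M M' :
  (forall i, Rabs (F i) <= M) -> (forall i, Rabs (F' i) <= M') ->
  mean (fun i => a * F i + b * F' i) = a * mean F + b * mean F'.
Proof.
  intros H H'. unfold mean. rewrite <- !Series_scal_l, <- Series_plus.
  - apply Series_ext. intro i. ring.
  - apply (ex_series_scal a (fun i => p i * F i)). now apply mean_ex with M.
  - apply (ex_series_scal b (fun i => p i * F' i)). now apply mean_ex with M'.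
Qed.

Lemma mean_partial F M n : (forall i, 0 <= F i <= M) -> sum_f_R0 (fun i => p i * F i) n <= mean F.
Proof.
  intro H. apply sum_incr.
  - change (infinite_sum (fun i => p i * F i) (mean F)).
    apply is_series_Reals, Series_correct, mean_ex with M.
    intro i. rewrite Rabs_pos_eq; apply H.
  - intro i. apply Rmult_le_pos; [easy|apply H].
Qed.

Lemma mean_nonneg F M : (forall i, 0 <= F i <= M) -> 0 <= mean F.
Proof.
  intro H. apply Rle_trans with (2 := mean_partial F M O H). simpl.
  apply Rmult_le_pos; [easy|apply H].
Qed.

Lemma mean_le F F' M M' :
  (forall i, Rabs (F i) <= M) -> (forall i, Rabs (F' i) <= M') ->
  (forall i, F i <= F' i) -> mean F <= mean F'.
Proof.
  intros H H' Hle. assert (Hd := mean_lin 1 (-1) F' F M' M H' H).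
  assert (0 <= mean (fun i => 1 * F' i + -1 * F i)); [|lra].
  apply mean_nonneg with (M' + M). intro i.
  generalize (H i) (H' i) (Hle i); intros A B D.
  apply Rabs_le_between in A, B. lra.
Qed.

Lemma mean_abs F M : (forall i, Rabs (F i) <= M) -> Rabs (mean F) <= M.
Proof.
  intro H. apply Rabs_le. rewrite <- (mean_const M) at 2. rewrite <- (mean_const (- M)).
  assert (HM : forall c i, Rabs ((fun _ : nat => c) i) <= Rabs c) by (intros; apply Rle_refl).
  split; [apply mean_le with (Rabs (- M)) M|apply mean_le with M (Rabs M)]; auto;
    intro i; specialize (H i); apply Rabs_le_between in H; lra.
Qed.

Fixpoint E (n : nat) (f : G -> R) : R :=
  match n with
  | O => f e
  | S n' => mean (fun i => E n' (fun g => f (s i ** g)))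
  end.

(** After n steps the walk stays in the ball of radius C n, so bounds are only asked there; [len]
    and the distances to moving points are unbounded on [G]. *)
Definition bounded_by (n : nat) (f : G -> R) (M : R) : Prop :=
  forall g, len g <= C * INR n -> Rabs (f g) <= M.
Definition bounded (n : nat) (f : G -> R) : Prop := exists M, bounded_by n f M.

Lemma C_nonneg : 0 <= C.
Proof. generalize (HsC 0) (len_nonneg (s 0)); lra. Qed.

Lemma len_step n i g : len g <= C * INR n -> len (s i ** g) <= C * INR (S n).
Proof. intro H. rewrite S_INR. generalize (lenM (s i) g) (HsC i); lra. Qed.

Lemma len_e n : len e <= C * INR n.
Proof. rewrite len1. apply Rmult_le_pos; [apply C_nonneg|apply pos_INR]. Qed.

Lemma len_prod n m g h : len g <= C * INR n -> len h <= C * INR m -> len (g ** h) <= C * INR (n + m).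
Proof. intros. rewrite plus_INR. generalize (lenM g h). lra. Qed.

Lemma bounded_step n i f M : bounded_by (S n) f M -> bounded_by n (fun g => f (s i ** g)) M.
Proof. intros H g Hg. now apply H, len_step. Qed.

Lemma E_abs n f M : bounded_by n f M -> Rabs (E n f) <= M.
Proof.
  revert f; induction n as [|n IH]; intros f H; [apply H, len_e|].
  apply mean_abs. intro i. apply IH. now apply bounded_step.
Qed.

Lemma E_ext n f f' : (forall g, len g <= C * INR n -> f g = f' g) -> E n f = E n f'.
Proof.
  revert f f'; induction n as [|n IH]; intros f f' H; [apply H, len_e|].
  apply mean_ext. intro i. apply IH. intros g Hg. now apply H, len_step.
Qed.

Lemma E_const n c : E n (fun _ => c) = c.
Proof.
  induction n as [|n IH]; [easy|]. simpl. transitivity (mean (fun _ => c)); [now apply mean_ext|apply mean_const].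
Qed.

Lemma E_lin n a b f f' :
  bounded n f -> bounded n f' -> E n (fun g => a * f g + b * f' g) = a * E n f + b * E n f'.
Proof.
  intros [M H] [M' H']. revert f f' H H'; induction n as [|n IH]; intros f f' H H'; [easy|].
  simpl. rewrite <- mean_lin with (M := M) (M' := M').
  - apply mean_ext. intro i. now apply IH; apply bounded_step.
  - intro i. now apply E_abs, bounded_step.
  - intro i. now apply E_abs, bounded_step.
Qed.

Lemma E_le n f f' :
  bounded n f -> bounded n f' -> (forall g, len g <= C * INR n -> f g <= f' g) -> E n f <= E n f'.
Proof.
  intros [M H] [M' H']. revert f f' H H'; induction n as [|n IH]; intros f f' H H' Hle;
    [apply Hle, len_e|].
  simpl. apply mean_le with M M'.
  - intro i. now apply E_abs, bounded_step.
  - intro i. now apply E_abs, bounded_step.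
  - intro i. apply IH; try now apply bounded_step. intros g Hg. now apply Hle, len_step.
Qed.

Lemma E_add n m f : E (n + m) f = E n (fun g => E m (fun h => f (g ** h))).
Proof.
  revert f; induction n as [|n IH]; intro f; simpl.
  - apply E_ext. intros g _. now rewrite mul1g.
  - apply mean_ext. intro i. rewrite IH. apply E_ext. intros g _. apply E_ext. intros h _.
    now rewrite mulA.
Qed.

Lemma bounded_const n c : bounded n (fun _ => c).
Proof. exists (Rabs c). intros g _. apply Rle_refl. Qed.

Lemma bounded_unit n f : (forall g, 0 <= f g <= 1) -> bounded n f.
Proof. intro H. exists 1. intros g _. rewrite Rabs_pos_eq; apply H. Qed.

Lemma bounded_lin n a b f f' :
  bounded n f -> bounded n f' -> bounded n (fun g => a * f g + b * f' g).
Proof.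
  intros [M H] [M' H']. exists (Rabs a * M + Rabs b * M'). intros g Hg.
  apply Rle_trans with (1 := Rabs_triang _ _). rewrite !Rabs_mult.
  generalize (Rabs_pos a) (Rabs_pos b) (H g Hg) (H' g Hg). intros.
  apply Rplus_le_compat; now apply Rmult_le_compat_l.
Qed.

Lemma bounded_E n m (F : G -> G -> R) M :
  (forall g h, len g <= C * INR n -> len h <= C * INR m -> Rabs (F g h) <= M) ->
  bounded n (fun g => E m (F g)).
Proof. intro H. exists M. intros g Hg. apply E_abs. intros h Hh. now apply H. Qed.

Lemma bounded_shift n m f u :
  len u <= C * INR n -> bounded (n + m) f -> bounded m (fun g => f (u ** g)).
Proof. intros Hu [M H]. exists M. intros g Hg. apply H. now apply len_prod. Qed.

Lemma E_plus n f f' : bounded n f -> bounded n f' -> E n (fun g => f g + f' g) = E n f + E n f'.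
Proof.
  intros H H'. transitivity (E n (fun g => 1 * f g + 1 * f' g)).
  - apply E_ext. intros; lra.
  - rewrite E_lin by easy. lra.
Qed.

Lemma E_scal n a f : bounded n f -> E n (fun g => a * f g) = a * E n f.
Proof.
  intro H. transitivity (E n (fun g => a * f g + 0 * f g)).
  - apply E_ext. intros; lra.
  - rewrite E_lin by easy. lra.
Qed.

Lemma E_affine n a b f : bounded n f -> E n (fun g => a * f g + b) = a * E n f + b.
Proof.
  intro H. rewrite (E_plus n (fun g => a * f g) (fun _ => b)), E_scal, E_const; auto using bounded_const.
  destruct (bounded_lin n a 0 f f H H) as [M HM]. exists M. intros g Hg.
  specialize (HM g Hg). simpl in HM. now replace (a * f g) with (a * f g + 0 * f g) by ring.
Qed.

Lemma E_nonneg n f : bounded n f -> (forall g, len g <= C * INR n -> 0 <= f g) -> 0 <= E n f.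
Proof. intros H H0. rewrite <- (E_const n 0). apply E_le; auto using bounded_const. Qed.

(** Apply [mean_partial] to the nonnegative functions M + F and M - F. *)
Lemma mean_tail F M n :
  (forall i, Rabs (F i) <= M) ->
  Rabs (mean F - sum_f_R0 (fun i => p i * F i) n) <= M * (1 - sum_f_R0 p n).
Proof.
  intro H.
  assert (Hsum : forall a b, sum_f_R0 (fun i => p i * (a * F i + b * 1)) n =
            a * sum_f_R0 (fun i => p i * F i) n + b * sum_f_R0 p n).
  { intros a b. rewrite !scal_sum, <- plus_sum. apply sum_eq. intros; ring. }
  assert (Hmean : forall a b, mean (fun i => a * F i + b * 1) = a * mean F + b).
  { intros a b. rewrite mean_lin with (F' := fun _ => 1) (M := M) (M' := 1), mean_const; [ring|easy|].
    intros; rewrite Rabs_R1; lra. }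
  assert (H1 := mean_partial (fun i => 1 * F i + M * 1) (2 * M) n).
  assert (H2 := mean_partial (fun i => -1 * F i + M * 1) (2 * M) n).
  cbv beta in H1, H2. rewrite Hsum, Hmean in H1, H2. apply Rabs_le.
  assert (HF : forall i, - M <= F i <= M) by (intro i; apply Rabs_le_between, H).
  assert (H1' := H1 (fun i => ltac:(generalize (HF i); lra))).
  assert (H2' := H2 (fun i => ltac:(generalize (HF i); lra))). lra.
Qed.

Lemma E_partial_sum m n (f : nat -> G -> R) M :
  (forall i, bounded_by m (f i) M) ->
  E m (fun h => sum_f_R0 (fun i => p i * f i h) n) = sum_f_R0 (fun i => p i * E m (f i)) n /\
  bounded m (fun h => sum_f_R0 (fun i => p i * f i h) n).
Proof.
  intro H. assert (Hb : forall i, bounded m (f i)) by (intro i; now exists M).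
  induction n as [|n [IH1 IH2]]; simpl.
  - split; [now apply E_scal|]. exists (p O * M). intros g Hg. rewrite Rabs_mult, (Rabs_pos_eq (p O)) by easy.
    apply Rmult_le_compat_l; [easy|now apply H].
  - split.
    + transitivity (E m (fun h => 1 * sum_f_R0 (fun i => p i * f i h) n + p (S n) * f (S n) h)).
      { apply E_ext. intros; lra. }
      rewrite E_lin by easy. rewrite IH1. lra.
    + destruct (bounded_lin m 1 (p (S n)) _ _ IH2 (Hb (S n))) as [M' HM']. exists M'.
      intros g Hg. specialize (HM' g Hg). simpl in HM'. now rewrite Rmult_1_l in HM'.
Qed.

(** Fubini: finite partial sums commute with [E] by linearity, and by [mean_tail] the remainder is
    at most [M] times the missing mass, uniformly in [h]. *)
Lemma E_mean m (f : nat -> G -> R) M :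
  (forall i, bounded_by m (f i) M) ->
  mean (fun i => E m (f i)) = E m (fun h => mean (fun i => f i h)).
Proof.
  intro H. apply is_series_unique, is_series_Reals. intros eps He.
  assert (HM : 0 <= M) by (apply Rle_trans with (2 := H O e (len_e m)); apply Rabs_pos).
  destruct (Hp1 (eps / (M + 1))) as [N HN]; [apply Rdiv_lt_0_compat; lra|].
  exists N. intros n Hn. specialize (HN n Hn). unfold R_dist in *. rewrite Rabs_minus_sym in HN |- *.
  destruct (E_partial_sum m n f M H) as [Hsum Hbd]. rewrite <- Hsum.
  assert (Hbm : bounded m (fun h => mean (fun i => f i h))).
  { exists M. intros h Hh. apply mean_abs. intro i. now apply H. }
  replace (E m (fun h => mean (fun i => f i h)) - E m (fun h => sum_f_R0 (fun i => p i * f i h) n))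
    with (E m (fun h => 1 * mean (fun i => f i h) + -1 * sum_f_R0 (fun i => p i * f i h) n))
    by (rewrite E_lin by easy; lra).
  apply Rle_lt_trans with (M * (1 - sum_f_R0 p n)).
  - apply E_abs. intros h Hh.
    replace (1 * mean (fun i => f i h) + -1 * sum_f_R0 (fun i => p i * f i h) n)
      with (mean (fun i => f i h) - sum_f_R0 (fun i => p i * f i h) n) by lra.
    apply mean_tail. intro i. now apply H.
  - assert (H1 : 1 - sum_f_R0 p n < eps / (M + 1)).
    { apply Rle_lt_trans with (2 := HN). apply Rle_abs. }
    apply Rle_lt_trans with (M * (eps / (M + 1))).
    + apply Rmult_le_compat_l; lra.
    + apply Rmult_lt_reg_r with (M + 1); [lra|]. field_simplify; [nra|lra].
Qed.

Lemma E_swap n m (F : G -> G -> R) M :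
  (forall g h, len g <= C * INR n -> len h <= C * INR m -> Rabs (F g h) <= M) ->
  E n (fun g => E m (fun h => F g h)) = E m (fun h => E n (fun g => F g h)).
Proof.
  revert F; induction n as [|n IH]; intros F H; [easy|]. simpl.
  rewrite <- E_mean with (M := M).
  - apply mean_ext. intro i. apply IH. intros g h Hg Hh. apply H; [now apply len_step|easy].
  - intros i h Hh. apply E_abs. intros g Hg. apply H; [now apply len_step|easy].
Qed.

Definition indicator (A : G -> Prop) (g : G) : R := if excluded_middle_informative (A g) then 1 else 0.

Lemma indicator_unit A g : 0 <= indicator A g <= 1.
Proof. unfold indicator. destruct excluded_middle_informative; lra. Qed.
Lemma indicator_in (A : G -> Prop) g : A g -> indicator A g = 1.
Proof. unfold indicator. now destruct excluded_middle_informative. Qed.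
Lemma indicator_out (A : G -> Prop) g : ~ A g -> indicator A g = 0.
Proof. unfold indicator. now destruct excluded_middle_informative. Qed.

(** Increments [s] and [s0] may differ on atoms of weight 0, whose terms vanish. In particular the
    relation [walk_prob] determines the value [r]. *)
Lemma walk_prob_E s0 n A r :
  (forall i, p i = 0 \/ s i = s0 i) ->
  walk_prob G mul e s0 p n A r -> r = E n (indicator A).
Proof.
  intros Hs H. induction H as [A HA|A HA|n A r t Hr IH Ht].
  - simpl. now rewrite indicator_in.
  - simpl. now rewrite indicator_out.
  - apply is_series_Reals, is_series_unique in Ht. rewrite <- Ht. simpl.
    apply Series_ext. intro i. rewrite IH. destruct (Hs i) as [->| <-]; [lra|].
    f_equal.
Qed.

(** Says that w_L equals [g] with probability at least beta, phrased by testing nonnegative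
    functions: in this form it composes through [E_add] and applies at once to events that depend on
    the rest of the path. *)
Definition reach (L : nat) (g : G) : Prop :=
  len g <= C * INR L /\
  exists beta, 0 < beta /\ forall F, bounded L F ->
    (forall h, len h <= C * INR L -> 0 <= F h) -> beta * F g <= E L F.

Lemma reach_e : reach 0 e.
Proof.
  split; [apply len_e|]. exists 1. split; [lra|]. intros F _ _. simpl. lra.
Qed.

Lemma reach_step i : 0 < p i -> reach 1 (s i).
Proof.
  intro Hi. split; [simpl; generalize (HsC i); lra|]. exists (p i). split; [easy|].
  intros F [M HM] HF. simpl.
  assert (Hlen : forall i, len (s i ** e) <= C * INR 1) by (intro j; rewrite mulg1; simpl; generalize (HsC j); lra).
  assert (HFM : forall i, 0 <= F (s i ** e) <= M).
  { intro j. split; [now apply HF|]. apply Rle_trans with (1 := Rle_abs _). now apply HM. }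
  apply Rle_trans with (2 := mean_partial _ M i HFM). rewrite <- (mulg1 (s i)) at 1.
  destruct i as [|i]; [simpl; lra|]. rewrite tech5.
  assert (0 <= sum_f_R0 (fun j => p j * F (s j ** e)) i); [|lra].
  apply cond_pos_sum. intro j. apply Rmult_le_pos; [easy|apply HFM].
Qed.

Lemma reach_mul L L' g h : reach L g -> reach L' h -> reach (L + L') (g ** h).
Proof.
  intros [Hg [b [Hb H]]] [Hh [b' [Hb' H']]]. split; [now apply len_prod|].
  exists (b * b'). split; [now apply Rmult_lt_0_compat|]. intros F HbF HF. rewrite E_add.
  assert (Hin : forall u, len u <= C * INR L -> 0 <= E L' (fun v => F (u ** v))).
  { intros u Hu. apply E_nonneg; [now apply bounded_shift with L|]. intros v Hv. now apply HF, len_prod. }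
  apply Rle_trans with (b * E L' (fun v => F (g ** v))).
  - rewrite Rmult_assoc. apply Rmult_le_compat_l; [lra|].
    apply (H' (fun v => F (g ** v))); [now apply bounded_shift with L|].
    intros v Hv. now apply HF, len_prod.
  - apply (H (fun u => E L' (fun v => F (u ** v)))); [|easy].
    destruct HbF as [M HM]. apply bounded_E with M. intros u v Hu Hv. now apply HM, len_prod.
Qed.

Lemma reach_pow L g k : reach L g -> reach (k * L) (pow g k).
Proof. intro H. induction k as [|k IH]; [apply reach_e|]. now apply reach_mul. Qed.

Lemma Gamma_reach s0 g :
  (forall i, p i = 0 \/ s i = s0 i) -> Gamma G mul s0 p g -> exists L, (1 <= L)%nat /\ reach L g.
Proof.
  intros Hs H. induction H as [g [i [Hi <-]]|g h _ [L [HL H]] _ [L' [HL' H']]].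
  - exists 1%nat. split; [lia|]. destruct (Hs i) as [E|E]; [lra|]. rewrite <- E. now apply reach_step.
  - exists (L + L')%nat. split; [lia|]. now apply reach_mul.
Qed.

Lemma pingpong_exists g h Lg Lh :
  lox g -> lox h -> disjoint_fixed X d G mul inv e act x0 g h ->
  reach Lg g -> reach Lh h -> (1 <= Lg)%nat -> (1 <= Lh)%nat ->
  exists c, 0 <= c /\ forall m, exists a b L, pingpong c m a b /\ reach L a /\ reach L b.
Proof.
  intros Hg Hh Hdis Rg Rh HLg HLh.
  assert (Hgi := lox_inv g Hg). assert (Hhi := lox_inv h Hh).
  destruct (lox_opposite g Hg) as [c1 [P1 Q1]]. destruct (lox_opposite h Hh) as [c2 [P2 Q2]].
  destruct (lox_separated g h Hg Hh) as [c3 [P3 Q3]]; [apply Hdis; tauto|].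
  destruct (lox_separated g (inv h) Hg Hhi) as [c4 [P4 Q4]]; [apply Hdis; tauto|].
  destruct (lox_separated (inv g) h Hgi Hh) as [c5 [P5 Q5]]; [apply Hdis; tauto|].
  destruct (lox_separated (inv g) (inv h) Hgi Hhi) as [c6 [P6 Q6]]; [apply Hdis; tauto|].
  exists (c1 + c2 + c3 + c4 + c5 + c6). split; [lra|]. intro m.
  destruct (lox_length g Hg) as [l [c7 [Hl [Hc7 Hlen]]]].
  destruct (lox_length h Hh) as [l' [c8 [Hl' [Hc8 Hlen']]]].
  destruct (archimed_nat (m / l)) as [k1 Hk1]. destruct (archimed_nat (m / l')) as [k2 Hk2].
  set (k := (k1 + k2)%nat).
  (* The crossed exponents make both letters take the same number of steps, so that all words with
     equally many letters have the same duration. The separation bounds hold for all powers, hence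
     do not depend on [k]. *)
  exists (pow g (k * Lh)), (pow h (k * Lg)), (k * Lh * Lg)%nat.
  split; [|split; [now apply reach_pow|]].
  2: { replace (k * Lh * Lg)%nat with (k * Lg * Lh)%nat by lia. now apply reach_pow. }
  assert (Hm : forall l u L kk, 0 < l -> (forall n, l * INR n <= len (pow u n)) -> m / l <= INR kk ->
     (kk <= k)%nat -> (1 <= L)%nat -> m <= len (pow u (k * L))).
  { intros t u L kk Ht Hu Hkk Hk HL. apply Rle_trans with (2 := Hu (k * L)%nat).
    assert (INR kk <= INR (k * L)) by (apply le_INR; nia).
    apply Rmult_le_reg_l with (/ t); [now apply Rinv_0_lt_compat|].
    rewrite <- Rmult_assoc, Rinv_l by lra. unfold Rdiv in Hkk. lra. }
  unfold pingpong. generalize (Q1 (k * Lh) (k * Lh))%nat (Q2 (k * Lg) (k * Lg))%nat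
    (Q3 (k * Lh) (k * Lg))%nat (Q4 (k * Lh) (k * Lg))%nat (Q5 (k * Lh) (k * Lg))%nat
    (Q6 (k * Lh) (k * Lg))%nat.
  rewrite !pow_inv. intros.
  repeat split; [lra|lra|rewrite gp_sym; lra|lra|rewrite gp_sym; lra|rewrite gp_sym; lra| |].
  - apply (Hm l g Lh k1); auto; [intro; apply Hlen|unfold k; lia].
  - apply (Hm l' h Lg k2); auto; [intro; apply Hlen'|unfold k; lia].
Qed.

(** * Uniform averages over words in a ping-pong pair *)

Section Words.
Variables a b : G.

Fixpoint avg (k : nat) (F : G -> R) : R :=
  match k with
  | O => F e
  | S k' => (avg k' (fun u => F (a ** u)) + avg k' (fun u => F (b ** u))) / 2
  end.

Fixpoint word (k : nat) (u : G) : Prop :=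
  match k with
  | O => u = e
  | S k' => exists v, word k' v /\ (u = a ** v \/ u = b ** v)
  end.

Lemma avg_le k F F' : (forall u, word k u -> F u <= F' u) -> avg k F <= avg k F'.
Proof.
  revert F F'; induction k as [|k IH]; intros F F' H; simpl; [now apply H|].
  assert (avg k (fun u => F (a ** u)) <= avg k (fun u => F' (a ** u))).
  { apply IH. intros u Hu. apply H. exists u; tauto. }
  assert (avg k (fun u => F (b ** u)) <= avg k (fun u => F' (b ** u))).
  { apply IH. intros u Hu. apply H. exists u; tauto. }
  lra.
Qed.

Lemma avg_lin k x y F F' : avg k (fun u => x * F u + y * F' u) = x * avg k F + y * avg k F'.
Proof.
  revert F F'; induction k as [|k IH]; intros F F'; simpl; [easy|]. rewrite !IH. lra.
Qed.

Lemma avg_const k c : avg k (fun _ => c) = c.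
Proof. induction k as [|k IH]; simpl; [easy|]. rewrite IH. lra. Qed.

Lemma avg_ge k F c : (forall u, word k u -> c <= F u) -> c <= avg k F.
Proof. intro H. rewrite <- (avg_const k c). now apply avg_le. Qed.

Lemma avg_ext k F F' : (forall u, F u = F' u) -> avg k F = avg k F'.
Proof.
  intro H. apply Rle_antisym; apply avg_le; intros; rewrite H; lra.
Qed.

Lemma avg_add j k F : avg (j + k) F = avg j (fun u => avg k (fun v => F (u ** v))).
Proof.
  revert F; induction j as [|j IH]; intro F; simpl.
  - apply avg_ext. intro u. now rewrite mul1g.
  - rewrite !IH. f_equal; f_equal; apply avg_ext; intro u; apply avg_ext; intro v; now rewrite mulA.
Qed.

Lemma avg_swap j k (F : G -> G -> R) :
  avg j (fun u => avg k (F u)) = avg k (fun v => avg j (fun u => F u v)).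
Proof.
  revert F; induction j as [|j IH]; intro F; simpl; [easy|]. rewrite !IH.
  transitivity (avg k (fun v => /2 * avg j (fun u => F (a ** u) v) + /2 * avg j (fun u => F (b ** u) v))).
  - rewrite avg_lin. lra.
  - apply avg_ext. intro; lra.
Qed.

Lemma avg_snoc k F : avg (S k) F = (avg k (fun u => F (u ** a)) + avg k (fun u => F (u ** b))) / 2.
Proof.
  rewrite <- Nat.add_1_r, avg_add. simpl.
  transitivity (avg k (fun u => /2 * F (u ** a) + /2 * F (u ** b))).
  - apply avg_ext. intro u. rewrite !mulg1. lra.
  - rewrite avg_lin. lra.
Qed.

Variables (c m K : R).
Hypothesis Hm : 2 * c + 4 * delta < m.
Hypothesis Hab : pingpong c m a b.
Hypothesis HaK : len a <= K.
Hypothesis HbK : len b <= K.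

Lemma word_len k u : word k u -> len u <= INR k * K.
Proof.
  revert u; induction k as [|k IH]; intros u Hu; [simpl in *; subst; rewrite len1; lra|].
  destruct Hu as [v [Hv Hu]]. specialize (IH v Hv). rewrite S_INR.
  destruct Hu as [->| ->]; [generalize (lenM a v)|generalize (lenM b v)]; lra.
Qed.

Lemma clear_letter z : clear_of_repellers c a b z ->
  clear_of_repellers c a b (a • z) /\ clear_of_repellers c a b (b • z).
Proof.
  assert (Hd := delta_nonneg). intros [H1 H2]. split.
  - apply clear_after_letter with m; auto; lra.
  - apply clear_of_repellers_sym, clear_after_letter with m; auto; [lra|now apply pingpong_sym].
Qed.

Lemma clear_word k u z : word k u -> clear_of_repellers c a b z -> clear_of_repellers c a b (u • z).
Proof.
  revert u; induction k as [|k IH]; intros u Hu Hz; [simpl in *; subst; now rewrite act1|].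
  destruct Hu as [v [Hv [->| ->]]]; rewrite actM; apply clear_letter; auto.
Qed.

Lemma d_word_lower k u z : word k u -> d x0 z - INR k * K <= d x0 (u • z) <= d x0 z + INR k * K.
Proof.
  intro Hu. apply word_len in Hu. unfold len in Hu.
  generalize (d_triangle x0 (u • x0) (u • z)) (d_triangle (u • x0) x0 (u • z)).
  rewrite d_act, (d_sym (u • x0)). lra.
Qed.

(** The outer letter decides: one of the two keeps every continuation away from [y], the other is
    handled by induction with [y] moved by its inverse. Each letter thus halves the deficit, from 2
    in the triangle inequality at [i = 0] to 2 / 2^i. *)
Lemma avg_drift_clear i : exists kappa, forall y z, clear_of_repellers c a b z ->
  d y x0 + (1 - 2 / 2 ^ i) * d x0 z - kappa <= avg i (fun u => d y (u • z)).
Proof.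
  assert (Hd := delta_nonneg).
  induction i as [|i [kappa IH]].
  - exists 0. intros y z _. simpl. rewrite act1. generalize (d_triangle y z x0). rewrite (d_sym z x0). lra.
  - exists ((2 * (c + 3 * delta) + INR (S i) * K + K + kappa) / 2). intros y z Hz.
    assert (Hgood : forall l, (l = a \/ l = b) ->
       (forall z, clear_of_repellers c a b z -> gp y (l • z) <= c + 3 * delta) ->
       d y x0 + d x0 z - 2 * (c + 3 * delta) - INR (S i) * K <= avg i (fun u => d y ((l ** u) • z))).
    { intros l Hl Hgp. apply avg_ge. intros u Hu.
      assert (Hlu : word (S i) (l ** u)) by (exists u; destruct Hl; subst; tauto).
      generalize (d_word_lower _ _ z Hlu) (Hgp (u • z) (clear_word _ _ _ Hu Hz)).
      rewrite <- actM. unfold gprod. rewrite (d_sym x0 y). lra. }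
    assert (Hany : forall l, len l <= K ->
       d y x0 - K + (1 - 2 / 2 ^ i) * d x0 z - kappa <= avg i (fun u => d y ((l ** u) • z))).
    { intros l Hl. specialize (IH (inv l • y) z Hz). generalize (d_orbit_lower y l).
      rewrite d_act_r. rewrite (avg_ext i _ (fun u => d (inv l • y) (u • z))); [lra|].
      intro u. now rewrite actM, d_act_r. }
    assert (Hpow : 0 < 2 ^ i) by (apply pow_lt; lra).
    replace (2 / 2 ^ (S i)) with (2 / 2 ^ i / 2) by (simpl; field; lra).
    simpl avg.
    destruct (one_attractor c m a b y Hm Hab) as [H|H].
    + generalize (Hgood a ltac:(tauto) H) (Hany b HbK). lra.
    + generalize (Hgood b ltac:(tauto) H) (Hany a HaK). lra.
Qed.

(** The same halving from the other end: one choice of the innermost letter clears [z] of the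
    repellers for good, the other falls back on the induction. On uncleared points only the triangle
    bound with coefficient -1 is assumed. *)
Lemma avg_reach_clear q (kappa : R) j : -1 <= q <= 1 -> exists kappa', forall A (g : X -> R),
  (forall z, A - d x0 z - kappa <= g z) ->
  (forall z, clear_of_repellers c a b z -> A + q * d x0 z - kappa <= g z) ->
  forall z, A + (q - 2 / 2 ^ j) * d x0 z - kappa' <= avg j (fun v => g (v • z)).
Proof.
  intro Hq. assert (Hd := delta_nonneg).
  assert (Hlip : forall r t t' x, -3 <= r <= 1 -> t - x <= t' <= t + x -> r * t - 3 * x <= r * t').
  { intros r t t' x Hr Ht. nra. }
  induction j as [|j [kappa' IH]].
  - exists kappa. intros A g H1 _ z. simpl. rewrite act1. generalize (H1 z) (d_nonneg x0 z). nra.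
  - exists ((kappa + 3 * (INR (S j) * K) + kappa' + 3 * K) / 2). intros A g H1 H2 z.
    rewrite avg_snoc.
    assert (Hpow : 1 <= 2 ^ j) by (apply pow_R1_Rle; lra).
    assert (Hinv : 0 < 2 / 2 ^ j <= 2).
    { split; [apply Rdiv_lt_0_compat; lra|]. apply Rmult_le_reg_r with (2 ^ j); [lra|].
      unfold Rdiv. rewrite Rmult_assoc, Rinv_l; lra. }
    assert (Hgood : forall l, len l <= K -> clear_of_repellers c a b (l • z) ->
       A + q * d x0 z - 3 * (INR (S j) * K) - kappa <= avg j (fun v => g ((v ** l) • z))).
    { intros l Hl Hlz. apply avg_ge. intros v Hv. rewrite actM.
      apply Rle_trans with (2 := H2 _ (clear_word _ _ _ Hv Hlz)).
      assert (Hx : d x0 z - INR (S j) * K <= d x0 (v • l • z) <= d x0 z + INR (S j) * K).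
      { rewrite S_INR. generalize (d_word_lower _ _ (l • z) Hv). unfold len in Hl.
        generalize (d_triangle x0 (l • x0) (l • z)) (d_triangle (l • x0) x0 (l • z)).
        rewrite d_act, (d_sym (l • x0)). lra. }
      generalize (Hlip q _ _ _ ltac:(lra) Hx). lra. }
    assert (Hany : forall l, len l <= K ->
       A + (q - 2 / 2 ^ j) * d x0 z - 3 * K - kappa' <= avg j (fun v => g ((v ** l) • z))).
    { intros l Hl. rewrite (avg_ext j _ (fun v => g (v • (l • z)))) by (intro; now rewrite actM).
      apply Rle_trans with (2 := IH A g H1 H2 (l • z)).
      assert (Hx : d x0 z - K <= d x0 (l • z) <= d x0 z + K).
      { unfold len in Hl. generalize (d_triangle x0 (l • x0) (l • z)) (d_triangle (l • x0) x0 (l • z)).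
        rewrite d_act, (d_sym (l • x0)). lra. }
      generalize (Hlip (q - 2 / 2 ^ j) _ _ _ ltac:(lra) Hx). lra. }
    replace (2 / 2 ^ (S j)) with (2 / 2 ^ j / 2) by (simpl; field; lra).
    destruct (one_repeller c m a b z Hab) as [H|H].
    + generalize (Hgood a HaK (clear_after_letter c m a b z ltac:(lra) Hab H)) (Hany b HbK). lra.
    + assert (Hbz : clear_of_repellers c a b (b • z)).
      { apply clear_of_repellers_sym, clear_after_letter with m; [lra|now apply pingpong_sym|easy]. }
      generalize (Hgood b HbK Hbz) (Hany a HaK). lra.
Qed.

(** Nine inner letters clear [z] and nine outer ones turn away from [y]; the total deficit is 4 /
    2^9, which is below 1/100. *)
Lemma avg_drift : exists kappa, forall y z,
  d y x0 + 99/100 * d x0 z - kappa <= avg 18 (fun u => d y (u • z)).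
Proof.
  destruct (avg_drift_clear 9) as [k1 H1].
  assert (HK : 0 <= K) by (generalize (len_nonneg a); lra).
  assert (Hw : forall y z, d y x0 - d x0 z - 9 * K <= avg 9 (fun u => d y (u • z))).
  { intros y z. apply avg_ge. intros u Hu. generalize (d_word_lower _ _ z Hu) (d_triangle y (u • z) x0).
    replace (INR 9) with 9 by (simpl; ring). rewrite (d_sym (u • z) x0). lra. }
  assert (Hq : -1 <= 1 - 2 / 2 ^ 9 <= 1) by (simpl; lra).
  destruct (avg_reach_clear (1 - 2 / 2 ^ 9) (Rmax k1 (9 * K)) 9 Hq) as [k2 H2].
  exists k2. intros y z. rewrite (avg_add 9 9), avg_swap.
  generalize (Rmax_l k1 (9 * K)) (Rmax_r k1 (9 * K)); intros M1 M2.
  rewrite (avg_ext 9 _ (fun v => avg 9 (fun u => d y (u • v • z))))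
    by (intro; apply avg_ext; intro; now rewrite actM).
  eapply Rle_trans; [|apply (H2 (d y x0) (fun z => avg 9 (fun u => d y (u • z))))].
  - generalize (d_nonneg x0 z). simpl. lra.
  - intro z'. generalize (Hw y z'). lra.
  - intros z' Hz'. generalize (H1 y z' Hz'). lra.
Qed.

(** A fixed fraction [beta] of the law of the walk is the uniform law on words. Testing the constant
    1 shows [beta <= 1]. *)
Lemma E_avg L k : reach L a -> reach L b ->
  exists beta, 0 < beta <= 1 /\ forall F, bounded (k * L) F ->
    (forall h, len h <= C * INR (k * L) -> 0 <= F h) -> beta * avg k F <= E (k * L) F.
Proof.
  intros [Ha [ba [Hba Ra]]] [Hb [bb [Hbb Rb]]].
  assert (H : exists beta, 0 < beta /\ forall F, bounded (k * L) F ->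
    (forall h, len h <= C * INR (k * L) -> 0 <= F h) -> beta * avg k F <= E (k * L) F).
  { induction k as [|k [beta [Hbeta IH]]].
    - exists 1. split; [lra|]. intros; simpl; lra.
    - exists (Rmin ba bb * beta).
      assert (Hmin : 0 < Rmin ba bb) by now apply Rmin_glb_lt.
      split; [now apply Rmult_lt_0_compat|]. intros F HbF HF. change (S k * L)%nat with (L + k * L)%nat in *.
      rewrite E_add. set (Phi := fun u => E (k * L) (fun v => F (u ** v))).
      assert (HPhi : forall u, len u <= C * INR L ->
         beta * avg k (fun v => F (u ** v)) <= Phi u /\ 0 <= Phi u).
      { intros u Hu. assert (Hbs : bounded (k * L) (fun v => F (u ** v))) by now apply bounded_shift with L.
        split.
        - apply IH; [easy|]. intros v Hv. now apply HF, len_prod.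
        - apply E_nonneg; [easy|]. intros v Hv. now apply HF, len_prod. }
      assert (HbPhi : bounded L Phi).
      { destruct HbF as [M HM]. apply bounded_E with M. intros u v Hu Hv. now apply HM, len_prod. }
      assert (E1 := Ra Phi HbPhi (fun u Hu => proj2 (HPhi u Hu))).
      assert (E2 := Rb Phi HbPhi (fun u Hu => proj2 (HPhi u Hu))).
      assert (E3 : Rmin ba bb * Phi a <= E L Phi).
      { apply Rle_trans with (2 := E1). apply Rmult_le_compat_r; [now apply HPhi|apply Rmin_l]. }
      assert (E4 : Rmin ba bb * Phi b <= E L Phi).
      { apply Rle_trans with (2 := E2). apply Rmult_le_compat_r; [now apply HPhi|apply Rmin_r]. }
      simpl avg.
      assert (E5 : Rmin ba bb * (beta * avg k (fun v => F (a ** v))) <= Rmin ba bb * Phi a).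
      { apply Rmult_le_compat_l; [lra|now apply HPhi]. }
      assert (E6 : Rmin ba bb * (beta * avg k (fun v => F (b ** v))) <= Rmin ba bb * Phi b).
      { apply Rmult_le_compat_l; [lra|now apply HPhi]. }
      fold Phi. lra. }
  destruct H as [beta [Hbeta H]]. exists beta. split; [split; [easy|]|easy].
  specialize (H (fun _ => 1) (bounded_const _ 1) ltac:(intros; lra)).
  rewrite avg_const, E_const in H. lra.
Qed.

End Words.

(** * Drift and concentration *)

Lemma bounded_dist n y u : bounded n (fun w => d y ((u ** w) • x0)).
Proof.
  exists (d y x0 + len u + C * INR n). intros w Hw. rewrite Rabs_pos_eq by apply d_nonneg.
  generalize (d_orbit_upper y (u ** w)) (lenM u w). lra.
Qed.

Lemma bounded_dist0 n y : bounded n (fun w => d y (w • x0)).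
Proof.
  destruct (bounded_dist n y e) as [M H]. exists M. intros w Hw. specialize (H w Hw).
  simpl in H. now rewrite mul1g in H.
Qed.

Lemma E_dist_shift n y u : E n (fun w => d y ((u ** w) • x0)) = E n (fun w => d (inv u • y) (w • x0)).
Proof. apply E_ext. intros w _. now rewrite actM, d_act_r. Qed.

Lemma bounded_E_dist n m y : bounded n (fun u => E m (fun w => d y ((u ** w) • x0))).
Proof.
  apply bounded_E with (M := d y x0 + C * INR (n + m)). intros u w Hu Hw.
  rewrite Rabs_pos_eq by apply d_nonneg.
  generalize (d_orbit_upper y (u ** w)) (len_prod _ _ _ _ Hu Hw). lra.
Qed.

Lemma E_len_lipschitz n k : E n len - C * INR k <= E (k + n) len <= E n len + C * INR k.
Proof.
  rewrite E_add.
  assert (Hu : forall u, len u <= C * INR k ->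
    E n len - C * INR k <= E n (fun w => len (u ** w)) <= E n len + C * INR k).
  { intros u Hu.
    assert (Haff : forall t, E n (fun w => 1 * len w + t) = E n len + t).
    { intro t. rewrite E_affine by apply bounded_dist0. lra. }
    assert (Hb : forall t, bounded n (fun w => 1 * len w + t)).
    { intro t. destruct (bounded_lin n 1 t len (fun _ => 1) (bounded_dist0 n x0) (bounded_const n 1)) as [M HM].
      exists M. intros g Hg. specialize (HM g Hg). simpl in HM. now rewrite Rmult_1_r in HM. }
    split.
    - replace (E n len - C * INR k) with (E n (fun w => 1 * len w + - (C * INR k))) by (rewrite Haff; lra).
      apply E_le; [apply Hb|apply bounded_dist|]. intros w _.
      generalize (lenM (inv u) (u ** w)). rewrite mulKg, lenV. lra.
    - rewrite <- Haff. apply E_le; [apply bounded_dist|apply Hb|]. intros w _. generalize (lenM u w). lra. }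
  assert (Hb := bounded_E_dist k n x0). change (bounded k (fun u => E n (fun w => len (u ** w)))) in Hb.
  split.
  - rewrite <- (E_const k (E n len - C * INR k)).
    apply E_le; [apply bounded_const|easy|]. intros u Hlu. now apply Hu.
  - rewrite <- (E_const k (E n len + C * INR k)).
    apply E_le; [easy|apply bounded_const|]. intros u Hlu. now apply Hu.
Qed.

Section Drift.
Hypothesis Hpairs : exists c, 0 <= c /\ forall m, exists a b L, pingpong c m a b /\ reach L a /\ reach L b.

(** After any beginning the expected distance is at least [phi]; subtracting [phi] makes it
    nonnegative, so the fraction [beta] of beginnings that are words can be credited with its own
    average. *)
Lemma E_first_letters a b L k n y phi :
  reach L a -> reach L b ->
  (forall u, len u <= C * INR (k * L) -> phi <= E n (fun w => d (inv u • y) (w • x0))) ->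
  forall beta, (forall F, bounded (k * L) F ->
    (forall h, len h <= C * INR (k * L) -> 0 <= F h) -> beta * avg a b k F <= E (k * L) F) ->
  phi + beta * (avg a b k (fun u => E n (fun w => d y ((u ** w) • x0))) - phi) <=
  E (k * L + n) (fun w => d y (w • x0)).
Proof.
  intros Ra Rb Hphi beta Hbeta. rewrite E_add.
  set (H := fun u => E n (fun w => d y ((u ** w) • x0))).
  assert (HbH : bounded (k * L) H) by apply bounded_E_dist.
  assert (HbH' : bounded (k * L) (fun u => 1 * H u + -phi * 1)) by (apply bounded_lin; auto using bounded_const).
  assert (H1 := Hbeta (fun u => 1 * H u + -phi * 1) HbH').
  rewrite avg_lin, avg_const, E_lin, E_const in H1 by auto using bounded_const.
  assert (H2 : forall h, len h <= C * INR (k * L) -> 0 <= 1 * H h + - phi * 1).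
  { intros u Hu. unfold H. rewrite E_dist_shift. generalize (Hphi u Hu). lra. }
  specialize (H1 H2). change (E (k * L) (fun g => E n (fun h => d y ((g ** h) • x0)))) with (E (k * L) H).
  lra.
Qed.

Lemma avg_E a b k n y :
  avg a b k (fun u => E n (fun w => d y ((u ** w) • x0))) =
  E n (fun w => avg a b k (fun u => d y (u • w • x0))) /\
  bounded n (fun w => avg a b k (fun u => d y (u • w • x0))).
Proof.
  revert y; induction k as [|k IH]; intro y; simpl.
  - split; [apply E_ext; intros; now rewrite actM|].
    destruct (bounded_dist n y e) as [M HM]. exists M. intros w Hw. specialize (HM w Hw). simpl in HM. now rewrite actM in HM.
  - assert (Hs : forall l, avg a b k (fun u => E n (fun w => d y ((l ** u ** w) • x0))) =
      avg a b k (fun u => E n (fun w => d (inv l • y) ((u ** w) • x0)))).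
    { intro l. apply avg_ext. intro u. apply E_ext. intros w _. now rewrite <- mulA, (actM l), d_act_r. }
    assert (Hs' : forall l w, avg a b k (fun u => d y ((l ** u) • w • x0)) =
      avg a b k (fun u => d (inv l • y) (u • w • x0))).
    { intros l w. apply avg_ext. intro u. now rewrite (actM l), d_act_r. }
    destruct (IH (inv a • y)) as [Ea Ba]. destruct (IH (inv b • y)) as [Eb Bb].
    assert (Hf : forall w, (avg a b k (fun u => d y ((a ** u) • w • x0)) + avg a b k (fun u => d y ((b ** u) • w • x0))) / 2
       = /2 * avg a b k (fun u => d (inv a • y) (u • w • x0)) + /2 * avg a b k (fun u => d (inv b • y) (u • w • x0))).
    { intro w. rewrite !Hs'. lra. }
    split.
    + rewrite !Hs, Ea, Eb.
      transitivity (E n (fun w => /2 * avg a b k (fun u => d (inv a • y) (u • w • x0)) +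
         /2 * avg a b k (fun u => d (inv b • y) (u • w • x0)))); [rewrite E_lin by easy; lra|].
      apply E_ext. intros w _. now rewrite Hf.
    + destruct (bounded_lin n (/2) (/2) _ _ Ba Bb) as [M HM]. exists M. intros w Hw.
      rewrite Hf. now apply HM.
Qed.

Lemma mean_dist_unbounded T : 0 < T -> exists n, forall y, T <= E n (fun w => d y (w • x0)).
Proof.
  intro HT. destruct Hpairs as [c [Hc Hp]]. assert (Hd := delta_nonneg).
  destruct (Hp (8 * T + 10 * c + 10 * delta + 1)) as [a [b [L [Hab [Ra Rb]]]]].
  destruct (E_avg a b L 2 Ra Rb) as [beta [Hbeta HE]].
  (* At least one of the four words achieves 8T, which explains the length demanded of the
     letters. *)
  assert (Havg : forall y z, 2 * T <= avg a b 2 (fun u => d y (u • z))).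
  { intros y z. destruct (two_letter_word_spec c (8 * T + 10 * c + 10 * delta + 1) a b y z ltac:(lra) Hab) as [u [Hu [H1 H2]]].
    assert (H3 : 8 * T <= d y (u • z)).
    { unfold gprod in H1. generalize (d_nonneg x0 y). lra. }
    simpl. rewrite !mulg1. unfold two_letter_words in Hu. simpl in Hu.
    generalize (d_nonneg y ((a ** a) • z)) (d_nonneg y ((a ** b) • z))
      (d_nonneg y ((b ** a) • z)) (d_nonneg y ((b ** b) • z)).
    destruct Hu as [<-|[<-|[<-|[<-|[]]]]]; lra. }
  (* While the bound is below T, words exceed it on average by at least T, so every round of 2L
     steps adds beta T. *)
  assert (Hk : forall k, exists n, forall y, Rmin T (INR k * (beta * T)) <= E n (fun w => d y (w • x0))).
  { induction k as [|k [n IH]].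
    - exists O. intro y. simpl. apply Rle_trans with (1 := Rmin_r _ _). generalize (d_nonneg y (e • x0)). lra.
    - destruct (Rle_or_lt T (INR k * (beta * T))) as [HkT|HkT].
      + exists n. intro y. apply Rle_trans with (2 := IH y). rewrite (Rmin_left T (INR k * _)) by easy. apply Rmin_l.
      + exists (2 * L + n)%nat. intro y.
        assert (Hmin : Rmin T (INR k * (beta * T)) = INR k * (beta * T)) by (apply Rmin_right; lra).
        rewrite Hmin in IH.
        eapply Rle_trans; [|apply (E_first_letters a b L 2 n y (INR k * (beta * T)) Ra Rb); [|exact HE]].
        * destruct (avg_E a b 2 n y) as [-> Hb].
          assert (H2 : 2 * T <= E n (fun w => avg a b 2 (fun u => d y (u • w • x0)))).
          { rewrite <- (E_const n (2 * T)). apply E_le; auto using bounded_const. }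
          apply Rle_trans with (1 := Rmin_r _ _). rewrite S_INR. nra.
        * intros u _. apply IH. }
  destruct (archimed_nat (/ beta)) as [k Hk0]. destruct (Hk k) as [n Hn]. exists n. intro y.
  apply Rle_trans with (2 := Hn y). apply Rmin_glb; [lra|].
  apply Rmult_le_compat_r with (r := beta * T) in Hk0; [|nra].
  rewrite <- Rmult_assoc, Rinv_l in Hk0; lra.
Qed.

Lemma uniform_drift : exists N, 1 <= E N len /\
  forall y, d y x0 + 97/100 * E N len <= E N (fun w => d y (w • x0)).
Proof.
  assert (HC := C_nonneg).
  destruct Hpairs as [c [Hc Hp]]. assert (Hd := delta_nonneg).
  destruct (Hp (2 * c + 4 * delta + 1)) as [a [b [l [Hab [Ra Rb]]]]].
  destruct (E_avg a b l 18 Ra Rb) as [beta [Hbeta HE]].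
  destruct (avg_drift a b c (2 * c + 4 * delta + 1) (Rmax (len a) (len b)) ltac:(lra) Hab
     (Rmax_l _ _) (Rmax_r _ _)) as [kappa Hkappa].
  set (L := (18 * l)%nat) in *.
  assert (Hstep : forall n phi, (forall y, d y x0 + phi <= E n (fun w => d y (w • x0))) -> forall y,
     d y x0 + ((1 - beta) * (phi - C * INR L) + beta * (99/100 * E n len - kappa)) <=
     E (L + n) (fun w => d y (w • x0))).
  { intros n phi Hphi y.
    eapply Rle_trans; [|apply (E_first_letters a b l 18 n y (d y x0 + phi - C * INR L) Ra Rb); [|exact HE]].
    - destruct (avg_E a b 18 n y) as [-> Hb].
      assert (H2 : E n (fun w => 99/100 * len w + (d y x0 - kappa)) <= E n (fun w => avg a b 18 (fun u => d y (u • w • x0)))).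
      { apply E_le; [|easy|].
        - destruct (bounded_lin n (99/100) (d y x0 - kappa) len (fun _ => 1) (bounded_dist0 n x0) (bounded_const n 1)) as [M HM].
          exists M. intros g Hg. specialize (HM g Hg). simpl in HM. now rewrite Rmult_1_r in HM.
        - intros w _. generalize (Hkappa y (w • x0)). unfold len. lra. }
      rewrite E_affine in H2 by apply bounded_dist0. nra.
    - intros u Hu. fold L in Hu. generalize (Hphi (inv u • y)) (d_orbit_lower y u).
      rewrite d_act_r. lra. }
  set (lam := 1 - beta).
  (* The coefficient of E|w_n| starts at -1 by the triangle inequality; a round replaces q by lam q
     + beta 99/100, whose fixed point is 99/100, so the initial gap 199/100 shrinks by [lam]. *)
  assert (Hiter : forall j, exists kap, forall n y,
     d y x0 + ((99/100 - 199/100 * lam ^ j) * E n len - kap) <= E (j * L + n) (fun w => d y (w • x0))).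
  { induction j as [|j [kap IH]].
    - exists 0. intros n y. simpl.
      assert (Hlow : E n (fun w => -1 * len w + d y x0) <= E n (fun w => d y (w • x0))).
      { apply E_le; [|apply bounded_dist0|].
        - destruct (bounded_lin n (-1) (d y x0) len (fun _ => 1) (bounded_dist0 n x0) (bounded_const n 1)) as [M HM].
          exists M. intros g Hg. specialize (HM g Hg). simpl in HM. now rewrite Rmult_1_r in HM.
        - intros w _. generalize (d_orbit_lower y w). lra. }
      rewrite E_affine in Hlow by apply bounded_dist0. lra.
    - exists (lam * (kap + C * INR L) + beta * (99/100 * (C * INR (j * L)) + kappa)). intros n y.
      replace (S j * L + n)%nat with (L + (j * L + n))%nat by lia.
      eapply Rle_trans; [|apply (Hstep (j * L + n)%nat _ (IH n))].
      assert (HA := proj1 (E_len_lipschitz n (j * L))).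
      assert (HA' : beta * (99/100 * (E n len - C * INR (j * L))) <= beta * (99/100 * E (j * L + n) len))
        by (apply Rmult_le_compat_l; lra).
      fold lam. change (lam ^ S j) with (lam * lam ^ j). set (X1 := lam ^ j) in *. set (X2 := E n len) in *.
      clearbody X1 X2. unfold lam. lra. }
  assert (Hlam : Rabs lam < 1) by (rewrite Rabs_pos_eq; unfold lam; lra).
  (* Brings the coefficient above 98/100. *)
  destruct (pow_lt_1_zero lam Hlam (1/199) ltac:(lra)) as [j Hj]. specialize (Hj j (le_n j)).
  rewrite Rabs_pos_eq in Hj by (apply pow_le; unfold lam; lra).
  destruct (Hiter j) as [kap Hkap].
  set (D := C * INR (j * L)).
  assert (HD : 0 <= D) by (apply Rmult_le_pos; [easy|apply pos_INR]).
  (* One percent of E|w_n| then outweighs both [kap] and the error [D] made in replacing [n] by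
     [j * L + n], which leaves 97/100. *)
  destruct (mean_dist_unbounded (1 + 2 * D + 100 * (D + Rabs kap))) as [n Hn].
  { generalize (Rabs_pos kap). lra. }
  specialize (Hn x0). change (E n (fun w => d x0 (w • x0))) with (E n len) in Hn.
  exists (j * L + n)%nat. generalize (E_len_lipschitz n (j * L)). fold D. intros [HA1 HA2].
  generalize (Rabs_pos kap) (Rle_abs kap). intros K1 K2. split; [lra|].
  intro y. apply Rle_trans with (2 := Hkap n y).
  assert ((98/100) * E n len <= (99 / 100 - 199 / 100 * lam ^ j) * E n len).
  { apply Rmult_le_compat_r; lra. }
  lra.
Qed.
End Drift.

(** * Probabilities of events and exponential moments *)

Definition prob (n : nat) (A : G -> Prop) : R := E n (indicator A).

Lemma bounded_indicator n A : bounded n (indicator A).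
Proof. apply bounded_unit, indicator_unit. Qed.

Lemma prob_le n (A B : G -> Prop) :
  (forall g, len g <= C * INR n -> A g -> B g) -> prob n A <= prob n B.
Proof.
  intro H. apply E_le; try apply bounded_indicator. intros g Hg.
  destruct (classic (A g)) as [HA|HA].
  - rewrite !indicator_in; auto; lra.
  - rewrite (indicator_out A) by easy. apply indicator_unit.
Qed.

Lemma prob_or n (A B : G -> Prop) : prob n (fun g => A g \/ B g) <= prob n A + prob n B.
Proof.
  unfold prob. rewrite <- E_plus by apply bounded_indicator. apply E_le.
  - apply bounded_indicator.
  - destruct (bounded_lin n 1 1 _ _ (bounded_indicator n A) (bounded_indicator n B)) as [M HM].
    exists M. intros g Hg. specialize (HM g Hg). simpl in HM. now rewrite !Rmult_1_l in HM.
  - intros g _. generalize (indicator_unit A g) (indicator_unit B g).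
    destruct (classic (A g)) as [HA|HA]; [rewrite (indicator_in (fun g => A g \/ B g)), (indicator_in A) by tauto; lra|].
    destruct (classic (B g)) as [HB|HB]; [rewrite (indicator_in (fun g => A g \/ B g)), (indicator_in B) by tauto; lra|].
    rewrite (indicator_out (fun g => A g \/ B g)) by tauto. lra.
Qed.

Lemma bounded_exp n f M : bounded_by n f M -> bounded n (fun g => exp (f g)).
Proof.
  intro H. exists (exp M). intros g Hg. rewrite Rabs_pos_eq by (left; apply exp_pos).
  specialize (H g Hg). apply Rabs_le_between in H. destruct (Rle_lt_or_eq_dec (f g) M) as [E1| ->]; [easy| |lra].
  left. now apply exp_increasing.
Qed.

Lemma exp_le_mono x y : x <= y -> exp x <= exp y.
Proof. intros [H| ->]; [left; now apply exp_increasing|lra]. Qed.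

Lemma prob_exp_markov n f M : bounded_by n f M -> prob n (fun g => 0 <= f g) <= E n (fun g => exp (f g)).
Proof.
  intro H. apply E_le; [apply bounded_indicator|now apply bounded_exp with M|].
  intros g _. destruct (classic (0 <= f g)) as [H0|H0].
  - rewrite indicator_in by easy. rewrite <- exp_0. now apply exp_le_mono.
  - rewrite indicator_out by easy. left. apply exp_pos.
Qed.

(** From exp(-u) >= 1 - u one gets exp u <= 1 / (1 - u), and (1 + u + 2u^2)(1 - u) = 1 + u^2 (1 -
    2u) >= 1. *)
Lemma exp_quadratic u : u <= 1 / 2 -> exp u <= 1 + u + 2 * u ^ 2.
Proof.
  intro Hu. assert (H := exp_ineq1_le (- u)). assert (Hp := exp_pos u).
  assert (He : exp u * exp (- u) = 1) by (rewrite <- exp_plus, Rplus_opp_r; apply exp_0).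
  assert (H1 : exp u * (1 - u) <= 1) by (rewrite <- He; apply Rmult_le_compat_l; lra).
  assert (H2 : 1 <= (1 + u + 2 * u ^ 2) * (1 - u)).
  { assert (0 <= u ^ 2 * (1 - 2 * u)) by (apply Rmult_le_pos; [apply pow2_ge_0|lra]). lra. }
  apply Rmult_le_reg_r with (1 - u); lra.
Qed.

Lemma exp_moment n f M theta t :
  bounded_by n f M -> E n f <= theta -> 0 < t -> t * M <= 1 / 2 ->
  E n (fun g => exp (t * f g)) <= exp (t * theta + 2 * (t * M) ^ 2).
Proof.
  intros Hf Hth Ht HtM.
  apply Rle_trans with (E n (fun g => t * f g + (1 + 2 * (t * M) ^ 2))).
  - apply E_le.
    + apply bounded_exp with (t * M). intros g Hg. rewrite Rabs_mult, (Rabs_pos_eq t) by lra.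
      apply Rmult_le_compat_l; [lra|now apply Hf].
    + destruct (bounded_lin n t (1 + 2 * (t * M) ^ 2) f (fun _ => 1)) as [M' HM'];
        [now exists M|apply bounded_const|].
      exists M'. intros g Hg. specialize (HM' g Hg). simpl in HM'. now rewrite Rmult_1_r in HM'.
    + intros g Hg. specialize (Hf g Hg). apply Rabs_le_between in Hf.
      assert (Hu : - (t * M) <= t * f g <= t * M) by nra.
      apply Rle_trans with (1 := exp_quadratic (t * f g) ltac:(lra)).
      assert ((t * f g) ^ 2 <= (t * M) ^ 2) by nra. lra.
  - rewrite E_affine by now exists M.
    apply Rle_trans with (2 := exp_ineq1_le _). nra.
Qed.

Section Concentration.
Variables (N : nat) (A : R).
Hypothesis HA : A = E N len.
Hypothesis HA1 : 1 <= A.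
Hypothesis Hdrift : forall y, d y x0 + 97/100 * A <= E N (fun w => d y (w • x0)).

Let M := C * INR N + 1.
(** Makes the second-order term 2 (t M)^2 of [exp_moment] equal to one percent of t A, so 97/100
    becomes 96/100 below and 1 becomes 101/100 above. *)
Let t := A / (200 * M ^ 2).

Lemma A_le_M : A <= M.
Proof.
  rewrite HA. apply Rle_trans with (1 := Rle_abs _). unfold M.
  apply Rle_trans with (C * INR N); [|lra]. apply E_abs. intros g Hg.
  now rewrite Rabs_pos_eq by apply len_nonneg.
Qed.

Lemma N_pos : (1 <= N)%nat.
Proof.
  destruct N as [|n] eqn:HN; [|lia]. exfalso. simpl in HA. rewrite len1 in HA. lra.
Qed.

Lemma t_facts : 0 < t /\ t * M <= 1 / 2 /\ 2 * (t * M) ^ 2 <= t * (A / 100).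
Proof.
  assert (HM := A_le_M). assert (HM2 : 0 < 200 * M ^ 2) by nra.
  assert (Ht : 0 < t) by (apply Rdiv_lt_0_compat; lra).
  assert (HtM : t * (200 * M ^ 2) = A) by (unfold t; field; lra).
  split; [easy|split; nra].
Qed.

Lemma bounded_exp_dist n y u : bounded n (fun w => exp (- t * d y ((u ** w) • x0))).
Proof.
  apply bounded_exp with (M := 0 + t * (d y x0 + len u + C * INR n)). intros w Hw.
  assert (Ht := proj1 t_facts). rewrite Rabs_mult, Rabs_Ropp, !Rabs_pos_eq by (try apply d_nonneg; lra).
  rewrite Rplus_0_l. apply Rmult_le_compat_l; [lra|].
  generalize (d_orbit_upper y (u ** w)) (lenM u w). lra.
Qed.

Lemma bounded_exp_dist0 n y : bounded n (fun w => exp (- t * d y (w • x0))).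
Proof.
  destruct (bounded_exp_dist n y e) as [M' H]. exists M'. intros w Hw. specialize (H w Hw).
  simpl in H. now rewrite mul1g in H.
Qed.

Lemma bounded_exp_len n u : bounded n (fun w => exp (t * len (u ** w))).
Proof.
  apply bounded_exp with (M := t * (len u + C * INR n)). intros w Hw.
  assert (Ht := proj1 t_facts). rewrite Rabs_mult, !Rabs_pos_eq by (try apply len_nonneg; lra).
  apply Rmult_le_compat_l; [lra|]. generalize (lenM u w). lra.
Qed.

Lemma bounded_exp_len0 n : bounded n (fun w => exp (t * len w)).
Proof.
  destruct (bounded_exp_len n e) as [M' H]. exists M'. intros w Hw. specialize (H w Hw).
  simpl in H. now rewrite mul1g in H.
Qed.

(** A supermartingale estimate: conditioning on the first N steps u replaces [y] by [inv u • y], to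
    which the induction hypothesis applies as it holds for all points. The [r] leftover steps are
    estimated trivially. *)
Lemma exp_moment_dist k r y :
  E (k * N + r) (fun w => exp (- t * d y (w • x0))) <=
  exp (- t * d y x0 - 96/100 * t * A * INR k + t * C * INR r).
Proof.
  destruct t_facts as [Ht [HtM HtM2]].
  revert y; induction k as [|k IH]; intro y.
  - simpl. rewrite <- (E_const r (exp _)). apply E_le; [apply bounded_exp_dist0|apply bounded_const|].
    intros w Hw. apply exp_le_mono. generalize (d_orbit_lower y w). nra.
  - replace (S k * N + r)%nat with (N + (k * N + r))%nat by lia. rewrite E_add.
    set (c := exp (- (96/100) * t * A * INR k + t * C * INR r)).
    apply Rle_trans with (E N (fun u => c * exp (- t * d y (u • x0)))).
    + apply E_le.
      * apply bounded_E with (M := 1). intros u w _ _. rewrite Rabs_pos_eq by (left; apply exp_pos).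
        rewrite <- exp_0. apply exp_le_mono. generalize (d_nonneg y ((u ** w) • x0)). nra.
      * destruct (bounded_lin N c 0 _ _ (bounded_exp_dist0 N y) (bounded_exp_dist0 N y)) as [M' HM'].
        exists M'. intros g Hg. specialize (HM' g Hg). simpl in HM'. now rewrite Rmult_0_l, Rplus_0_r in HM'.
      * intros u _. rewrite (E_ext _ _ (fun w => exp (- t * d (inv u • y) (w • x0))))
          by (intros; now rewrite actM, d_act_r).
        apply Rle_trans with (1 := IH _). unfold c. rewrite <- exp_plus. apply exp_le_mono.
        rewrite d_act_r. lra.
    + rewrite E_scal by apply bounded_exp_dist0.
      assert (Hm : E N (fun w => exp (t * (-1 * d y (w • x0) + d y x0))) <=
         exp (t * - (97/100 * A) + 2 * (t * M) ^ 2)).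
      { apply exp_moment; auto.
        - intros w Hw. apply Rabs_le. unfold M. generalize (d_orbit_lower y w) (d_orbit_upper y w). lra.
        - rewrite E_affine by apply bounded_dist0. generalize (Hdrift y). lra. }
      rewrite (E_ext _ _ (fun w => exp (t * d y x0) * exp (- t * d y (w • x0)))) in Hm
        by (intros; rewrite <- exp_plus; f_equal; ring).
      rewrite E_scal in Hm by apply bounded_exp_dist0.
      assert (Hx : E N (fun w => exp (- t * d y (w • x0))) <= exp (- t * d y x0 - 96/100 * t * A)).
      { apply Rmult_le_reg_l with (exp (t * d y x0)); [apply exp_pos|].
        apply Rle_trans with (1 := Hm). rewrite <- exp_plus. apply exp_le_mono. lra. }
      apply Rle_trans with (c * exp (- t * d y x0 - 96/100 * t * A)).
      * apply Rmult_le_compat_l; [left; apply exp_pos|easy].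
      * unfold c. rewrite <- exp_plus, S_INR. apply exp_le_mono. lra.
Qed.

Lemma exp_moment_len k r :
  E (k * N + r) (fun w => exp (t * len w)) <= exp (101/100 * t * A * INR k + t * C * INR r).
Proof.
  destruct t_facts as [Ht [HtM HtM2]].
  induction k as [|k IH].
  - simpl. rewrite <- (E_const r (exp _)). apply E_le; [apply bounded_exp_len0|apply bounded_const|].
    intros w Hw. apply exp_le_mono. nra.
  - replace (S k * N + r)%nat with (N + (k * N + r))%nat by lia. rewrite E_add.
    set (c := exp (101/100 * t * A * INR k + t * C * INR r)) in *.
    apply Rle_trans with (E N (fun u => c * exp (t * len u))).
    + apply E_le.
      * apply bounded_E with (M := exp (t * (C * INR (N + (k * N + r))))). intros u w Hu Hw.
        rewrite Rabs_pos_eq by (left; apply exp_pos). apply exp_le_mono.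
        apply Rmult_le_compat_l; [lra|now apply len_prod].
      * destruct (bounded_lin N c 0 _ _ (bounded_exp_len0 N) (bounded_exp_len0 N)) as [M' HM'].
        exists M'. intros g Hg. specialize (HM' g Hg). simpl in HM'. now rewrite Rmult_0_l, Rplus_0_r in HM'.
      * intros u _. apply Rle_trans with (E (k * N + r) (fun w => exp (t * len u) * exp (t * len w))).
        -- apply E_le; [apply bounded_exp_len| |].
           ++ destruct (bounded_lin (k * N + r) (exp (t * len u)) 0 _ _ (bounded_exp_len0 _) (bounded_exp_len0 _)) as [M' HM'].
              exists M'. intros g Hg. specialize (HM' g Hg). simpl in HM'. now rewrite Rmult_0_l, Rplus_0_r in HM'.
           ++ intros w _. rewrite <- exp_plus. apply exp_le_mono. generalize (lenM u w). nra.
        -- rewrite E_scal by apply bounded_exp_len0. rewrite Rmult_comm.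
           apply Rmult_le_compat_r; [left; apply exp_pos|easy].
    + rewrite E_scal by apply bounded_exp_len0.
      assert (Hm : E N (fun w => exp (t * len w)) <= exp (t * A + 2 * (t * M) ^ 2)).
      { apply exp_moment; auto; [|lra].
        intros w Hw. rewrite Rabs_pos_eq by apply len_nonneg. unfold M. lra. }
      apply Rle_trans with (c * exp (t * A + 2 * (t * M) ^ 2)).
      * apply Rmult_le_compat_l; [left; apply exp_pos|easy].
      * unfold c. rewrite <- exp_plus, S_INR. apply exp_le_mono. lra.
Qed.

Definition good_block (k : nat) (y : X) (w : G) : Prop :=
  9/10 * A * INR k <= len w /\ gp y (w • x0) <= 1/8 * A * INR k.

(** With j = n / N, outside three Chernoff events |w| is between 0.95 A j and 1.02 A j, and d(y, w
    x0) exceeds d(y, x0) by 0.95 A j. The product is then at most 0.035 A j, and j <= 3k turns this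
    into less than A k / 8. The range up to 3kN leaves room for a block that absorbs a remainder. *)
Lemma good_block_prob : exists K tau, 0 < K /\ 0 < tau /\ forall k n y,
  (k * N <= n <= 3 * k * N)%nat ->
  prob n (fun w => ~ good_block k y w) <= K * exp (- tau * INR k).
Proof.
  destruct t_facts as [Ht [HtM HtM2]]. assert (HN := N_pos). assert (HC := C_nonneg).
  set (tau := t * A / 100).
  assert (Htau : 0 < tau) by (unfold tau; nra).
  exists (3 * exp (t * C * INR N)), tau. split; [generalize (exp_pos (t * C * INR N)); lra|split; [easy|]].
  intros k n y Hn.
  set (j := (n / N)%nat). set (r := (n mod N)%nat).
  assert (Hjr : n = (j * N + r)%nat) by (unfold j, r; generalize (Nat.div_mod_eq n N); lia).
  assert (Hr : (r < N)%nat) by (apply Nat.mod_upper_bound; lia).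
  assert (Hj : (k <= j <= 3 * k)%nat) by nia.
  assert (Hj1 : INR k <= INR j) by (apply le_INR; lia).
  assert (Hj3 : INR j <= 3 * INR k) by (replace 3 with (INR 3) by (simpl; ring); rewrite <- mult_INR; apply le_INR; lia).
  assert (HrN : t * C * INR r <= t * C * INR N).
  { apply Rmult_le_compat_l; [nra|]. apply le_INR; lia. }
  assert (Htk : tau * INR k <= tau * INR j) by (apply Rmult_le_compat_l; lra).
  assert (Hlow : forall z, prob n (fun w => 0 <= t * (d z x0 + 95/100 * A * INR j) + - t * d z (w • x0)) <=
     exp (t * C * INR N) * exp (- tau * INR k)).
  { intro z. set (c0 := t * (d z x0 + 95/100 * A * INR j)).
    eapply Rle_trans; [apply (prob_exp_markov n) with (M := Rabs c0 + t * (d z x0 + C * INR n))|].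
    - intros w Hw. apply Rle_trans with (1 := Rabs_triang _ _). apply Rplus_le_compat_l.
      rewrite Rabs_mult, Rabs_Ropp, !Rabs_pos_eq by (try apply d_nonneg; lra).
      apply Rmult_le_compat_l; [lra|]. generalize (d_orbit_upper z w). lra.
    - rewrite (E_ext _ _ (fun w => exp c0 * exp (- t * d z (w • x0)))) by (intros; now rewrite exp_plus).
      rewrite E_scal by apply bounded_exp_dist0. rewrite Hjr at 1.
      apply Rle_trans with (exp c0 * exp (- t * d z x0 - 96/100 * t * A * INR j + t * C * INR r)).
      + apply Rmult_le_compat_l; [left; apply exp_pos|apply exp_moment_dist].
      + rewrite <- !exp_plus. apply exp_le_mono. unfold c0. unfold tau in *. lra. }
  assert (Hup : prob n (fun w => 0 <= - t * (102/100 * A * INR j) + t * len w) <=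
     exp (t * C * INR N) * exp (- tau * INR k)).
  { set (c0 := - t * (102/100 * A * INR j)).
    eapply Rle_trans; [apply (prob_exp_markov n) with (M := Rabs c0 + t * (C * INR n))|].
    - intros w Hw. apply Rle_trans with (1 := Rabs_triang _ _). apply Rplus_le_compat_l.
      rewrite Rabs_mult, !Rabs_pos_eq by (try apply len_nonneg; lra).
      apply Rmult_le_compat_l; lra.
    - rewrite (E_ext _ _ (fun w => exp c0 * exp (t * len w))) by (intros; now rewrite exp_plus).
      rewrite E_scal by apply bounded_exp_len0. rewrite Hjr at 1.
      apply Rle_trans with (exp c0 * exp (101/100 * t * A * INR j + t * C * INR r)).
      + apply Rmult_le_compat_l; [left; apply exp_pos|apply exp_moment_len].
      + rewrite <- !exp_plus. apply exp_le_mono. unfold c0. unfold tau in *. lra. }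
  eapply Rle_trans; [apply prob_le with (B := fun w => 0 <= t * (d y x0 + 95/100 * A * INR j) + - t * d y (w • x0) \/
     (0 <= t * (d x0 x0 + 95/100 * A * INR j) + - t * d x0 (w • x0) \/ 0 <= - t * (102/100 * A * INR j) + t * len w))|].
  - intros w _ Hbad. apply NNPP; intro Hno. apply Hbad.
    apply not_or_and in Hno. destruct Hno as [H1 H2]. apply not_or_and in H2. destruct H2 as [H2 H3].
    apply Rnot_le_lt in H1, H2, H3. rewrite d_self in H2.
    assert (H1' : d y x0 + 95/100 * A * INR j < d y (w • x0)) by nra.
    assert (H2' : 95/100 * A * INR j < len w) by (unfold len; nra).
    assert (H3' : len w < 102/100 * A * INR j) by nra.
    assert (Hk0 := pos_INR k).
    assert (HAk : A * INR k <= A * INR j) by (apply Rmult_le_compat_l; lra).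
    assert (HAj : A * INR j <= A * (3 * INR k)) by (apply Rmult_le_compat_l; lra).
    split; [nra|].
    unfold gprod. unfold len in H3'. rewrite (d_sym x0 y). nra.
  - eapply Rle_trans; [apply prob_or|]. eapply Rle_trans; [apply Rplus_le_compat_l, prob_or|].
    generalize (Hlow y) (Hlow x0). lra.
Qed.
End Concentration.

(** * Blocks and slots *)

Lemma reach_uniform L (l : list G) :
  (forall g, In g l -> reach L g) ->
  exists beta, 0 < beta /\ forall g, In g l -> forall F, bounded L F ->
    (forall h, len h <= C * INR L -> 0 <= F h) -> beta * F g <= E L F.
Proof.
  induction l as [|u l IH]; intro H; [exists 1; split; [lra|easy]|].
  destruct IH as [b [Hb IH]]; [intros; apply H; now right|].
  destruct (H u (or_introl eq_refl)) as [Hu [b' [Hb' Hr]]].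
  exists (Rmin b b'). split; [now apply Rmin_glb_lt|].
  assert (Hlen : forall g, In g (u :: l) -> len g <= C * INR L) by (intros g Hg; now apply H).
  intros g Hg F HbF HF. assert (HFg := HF g (Hlen g Hg)). destruct Hg as [<-|Hg].
  - apply Rle_trans with (b' * F u); [apply Rmult_le_compat_r; [easy|apply Rmin_r]|]. now apply Hr.
  - apply Rle_trans with (b * F g); [apply Rmult_le_compat_r; [easy|apply Rmin_l]|]. now apply IH.
Qed.

Section Slots.
Variables (c1 : R) (T : list G) (f : G) (Kw : R).
Hypothesis Hc1 : 0 <= c1.
Hypothesis HT : forall y z, exists u, In u T /\ gp y (u • z) <= c1.
Hypothesis HTK : forall u, In u T -> len u <= Kw.
Let r := c1 + delta + 2 * Kw.
Hypothesis Hflen : 2 * r + 3 * delta + 1 <= len f.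
Hypothesis Hffin : finite_set G (Stab X d G act (2 * (r + 4 * delta) + 1 + 2 * delta) x0 (f • x0)).

(** [u] turns the copy of [f] away from the incoming block, [u'] turns the outgoing block away from
    [f]. Only the two neighbouring blocks enter, so given the blocks the slots succeed
    independently. *)
Definition success (b b' sigma : G) : Prop :=
  exists u u', In u T /\ In u' T /\ sigma = u ** f ** u' /\
    gp (inv b • x0) ((u ** f) • x0) <= c1 /\ gp (inv f • x0) ((u' ** b') • x0) <= c1.

Lemma Kw_nonneg : 0 <= Kw.
Proof.
  destruct (HT x0 x0) as [u [Hu _]]. generalize (HTK u Hu) (len_nonneg u). lra.
Qed.

Lemma success_exists b b' : exists u u', In u T /\ In u' T /\ success b b' (u ** f ** u').
Proof.
  destruct (HT (inv b • x0) (f • x0)) as [u [Hu H1]].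
  destruct (HT (inv f • x0) (b' • x0)) as [u' [Hu' H2]].
  exists u, u'. split; [easy|split; [easy|]]. exists u, u'. now rewrite !actM.
Qed.

(** [alpha] is uniform in the blocks because only finitely many elements [u ** f ** u'] are
    candidates, all reached in the same time. *)
Lemma success_prob L : (forall u u', In u T -> In u' T -> reach L (u ** f ** u')) ->
  exists alpha, 0 < alpha <= 1 /\ forall b b', alpha <= E L (indicator (success b b')).
Proof.
  intro HR.
  destruct (reach_uniform L (map (fun q => fst q ** f ** snd q) (list_prod T T))) as [beta [Hb Hbeta]].
  { intros g Hg. apply in_map_iff in Hg. destruct Hg as [[u u'] [<- Huu]]. apply in_prod_iff in Huu.
    now apply HR. }
  assert (H : forall b b', beta <= E L (indicator (success b b'))).
  { intros b b'. destruct (success_exists b b') as [u [u' [Hu [Hu' Hs]]]].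
    rewrite <- (Rmult_1_r beta). rewrite <- (indicator_in (success b b') (u ** f ** u') Hs).
    apply Hbeta.
    - apply in_map_iff. exists (u, u'). split; [easy|]. now apply in_prod.
    - apply bounded_indicator.
    - intros h _. apply indicator_unit. }
  exists beta. split; [split; [easy|]|easy].
  apply Rle_trans with (1 := H e e). rewrite <- (E_const L 1).
  apply E_le; [apply bounded_indicator|apply bounded_const|]. intros; apply indicator_unit.
Qed.

(** Conjugation by [u] brings the cyclic word to [f ** (u' ** W ** u)], where [W] starts along [b']
    and its inverse along [inv b]. The success conditions pass to [W] at the cost of [delta], and
    absorbing [u] and [u'] costs at most 2 Kw; this is the origin of [r]. *)
Lemma success_WPD b b' W sigma t :
  success b b' sigma ->
  t <= gp (b' • x0) (W • x0) -> t <= gp (inv b • x0) (inv W • x0) ->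
  2 * r + 3 * delta + 1 + 2 * Kw <= t ->
  exists k, isWPD (k ** (sigma ** W) ** inv k).
Proof.
  intros (u & u' & Hu & Hu' & -> & H1 & H2) HW HW' Ht.
  assert (HK := Kw_nonneg). assert (Hd := delta_nonneg).
  assert (HlenW : t <= len W) by (apply Rle_trans with (1 := HW), gp_le_r).
  apply HTK in Hu, Hu'.
  exists (inv u). replace (inv u ** (u ** f ** u' ** W) ** inv (inv u)) with (f ** (u' ** W ** u)).
  2: { now rewrite invK, <- !mulA, mulKg. }
  apply concat_WPD with r; auto.
  - apply Rle_trans with (1 := gp_change x0 _ _ ((u' ** W) • x0)).
    rewrite (actM (u' ** W) u), d_act, d_sym. fold (len u).
    assert (Hn : t - len u' <= gp ((u' ** b') • x0) ((u' ** W) • x0)).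
    { rewrite !actM. assert (Hb := gp_change_base (inv u' • x0) x0 (b' • x0) (W • x0)).
      assert (Hb' := gp_change_base x0 (inv u' • x0) (b' • x0) (W • x0)).
      fold (len (inv u')) in Hb'. rewrite lenV in Hb'.
      rewrite <- (gp_act u' (inv u' • x0)), actKV in Hb'. lra. }
    destruct (hyp_or x0 (inv f • x0) ((u' ** W) • x0) ((u' ** b') • x0)) as [E'|E'].
    + unfold r. lra.
    + rewrite (gp_sym _ ((u' ** W) • x0)) in E'. unfold r in *. lra.
  - assert (Hinv : inv (u' ** W ** u) = inv u ** inv W ** inv u') by now rewrite !invM, mulA.
    rewrite Hinv. apply Rle_trans with (1 := gp_change_l x0 _ ((inv u ** inv W) • x0) _).
    rewrite (actM (inv u ** inv W) (inv u')), d_act, d_sym. fold (len (inv u')). rewrite lenV.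
    assert (Hn : gp (inv W • x0) ((u ** f) • x0) <= c1 + delta).
    { destruct (hyp_or x0 (inv b • x0) (inv W • x0) ((u ** f) • x0)) as [E'|E'];
        [unfold r in *; lra|lra]. }
    rewrite actM, <- (actK u (f • x0)).
    assert (Hb := gp_change_base x0 (inv u • x0) (inv u • inv W • x0) (inv u • u • f • x0)).
    rewrite (gp_act (inv u)) in Hb. fold (len (inv u)) in Hb. rewrite lenV in Hb.
    rewrite actM in Hn. unfold r. lra.
  - unfold r. lra.
  - generalize (lenM (inv u') (u' ** W ** u ** inv u)) (lenM (u' ** W ** u) (inv u)).
    rewrite mulgK, mulKg, !lenV. lra.
Qed.

(** * Chains of slots and blocks *)

Definition increments (l : list (G * G)) : list G := map (fun q => fst q ** snd q) l.
Definition last_block (b : G) (l : list (G * G)) : G := last (map snd l) b.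

Lemma last_default (T' : Type) (l : list T') t t' v : last (v :: l) t = last (v :: l) t'.
Proof. revert v; induction l as [|v' l IH]; intro v; [easy|]. apply (IH v'). Qed.

Lemma last_cons (T' : Type) (l : list T') v t : last (v :: l) t = last l v.
Proof. destruct l as [|v' l]; [easy|]. exact (last_default T' l t v v'). Qed.

Lemma last_app_cons (T' : Type) (l l' : list T') v t : last (l ++ v :: l') t = last l' v.
Proof.
  revert t; induction l as [|v' l IH]; intro t; [apply last_cons|].
  simpl app. rewrite last_cons. apply IH.
Qed.

Variables (D rho ell : R).

Definition junction (b sigma b' : G) : Prop :=
  len sigma <= D /\ ell <= len b' /\ gp (inv (b ** sigma) • x0) (b' • x0) <= rho.

Fixpoint good_chain (b : G) (l : list (G * G)) : Prop :=
  match l with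
  | nil => True
  | (sigma, b') :: l' => junction b sigma b' /\ good_chain b' l'
  end.

Lemma good_chain_app b l sigma b' l' :
  good_chain b (l ++ (sigma, b') :: l') <->
  good_chain b l /\ junction (last_block b l) sigma b' /\ good_chain b' l'.
Proof.
  revert b; induction l as [|[tau c] l IH]; intro b; simpl; [tauto|].
  rewrite IH. unfold last_block. simpl map. rewrite last_cons. tauto.
Qed.

(** Each slot is fused with the block after it, so that [linked] applies. This costs [D] in length
    and 2 D in the products: one [D] for seeing [inv v] in place of [inv b], one for moving the base
    point across the slot. *)
Lemma good_chain_linked b v l :
  d (inv v • x0) (inv b • x0) <= D -> good_chain b l ->
  linked (rho + 2 * D) (ell - D) v (increments l) /\
  d (inv (last (increments l) v) • x0) (inv (last_block b l) • x0) <= D.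
Proof.
  revert b v; induction l as [|[sigma b'] l IH]; intros b v Hv Hl; [split; [easy|exact Hv]|].
  destruct Hl as [(H1 & H2 & H3) Hl].
  assert (Hv' : d (inv (sigma ** b') • x0) (inv b' • x0) <= D).
  { rewrite invM, actM, d_act, d_sym. fold (len (inv sigma)). now rewrite lenV. }
  destruct (IH b' (sigma ** b') Hv' Hl) as [IH1 IH2].
  change (increments ((sigma, b') :: l)) with ((sigma ** b') :: increments l)%list.
  unfold last_block. simpl map. rewrite !last_cons. split; [|easy].
  split; [|split; [|easy]].
  - apply Rle_trans with (1 := gp_change_l x0 _ (inv b • x0) _).
    assert (Hb := gp_change_base (inv sigma • x0) x0 (inv (b ** sigma) • x0) (b' • x0)).
    rewrite d_sym in Hb. fold (len (inv sigma)) in Hb. rewrite lenV in Hb.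
    rewrite <- (gp_act sigma), actKV, <- (actM sigma b'), <- (actM sigma), invM, mulKVg in Hb.
    rewrite invM in H3. lra.
  - generalize (lenM (inv sigma) (sigma ** b')). rewrite mulKg, lenV. lra.
Qed.

Definition total (b : G) (l : list (G * G)) : G := b ** lprod (increments l).

(* A cyclic permutation of the word brings the successful slot in front; the remaining
   part of the word starts with the block after the slot and ends with the block before it. *)
Lemma good_chain_WPD b l sigma b' l' :
  2 * (rho + 2 * D) + 2 * delta < ell - D ->
  2 * r + 4 * delta + 1 + 2 * Kw + rho + 5 * D <= ell ->
  0 <= rho -> 0 <= D -> ell <= len b ->
  good_chain b (l ++ (sigma, b') :: l') ->
  gp (inv (last_block b (l ++ (sigma, b') :: l')) • x0) (b • x0) <= rho ->
  success (last_block b l) b' sigma ->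
  isWPD (total b (l ++ (sigma, b') :: l')).
Proof.
  intros Hell1 Hell2 Hrho HD Hb Hchain Hcyc Hs. assert (Hd := delta_nonneg).
  apply good_chain_app in Hchain. destruct Hchain as (Hl & (Hj1 & Hj2 & Hj3) & Hl').
  set (W := b' ** lprod (increments l' ++ b :: increments l)).
  assert (Hself : forall g, d (inv g • x0) (inv g • x0) <= D) by (intro; now rewrite d_self).
  destruct (good_chain_linked b b l (Hself b) Hl) as [L1 N1].
  destruct (good_chain_linked b' b' l' (Hself b') Hl') as [L2 N2].
  assert (Hlast : last_block b (l ++ (sigma, b') :: l') = last_block b' l').
  { unfold last_block. rewrite map_app. apply last_app_cons. }
  rewrite Hlast in Hcyc.
  assert (HL : linked (rho + 2 * D) (ell - D) b' (increments l' ++ b :: increments l)).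
  { apply linked_app. split; [easy|]. split; [|split; [lra|easy]].
    apply Rle_trans with (1 := gp_change_l x0 _ (inv (last_block b' l') • x0) _). lra. }
  assert (H0 : 0 <= rho + 2 * D) by lra. assert (Hb' : ell - D <= len b') by lra.
  assert (HW1 := linked_prod_first (rho + 2 * D) (ell - D) b' _ H0 Hell1 HL).
  destruct (linked_prod_last (rho + 2 * D) (ell - D) b' _ H0 Hell1 Hb' HL) as [HW2 HW3].
  rewrite last_app_cons in HW2, HW3. fold W in HW1, HW3.
  assert (HW4 := gp_change_l x0 (inv (last (increments l) b) • x0) (inv (last_block b l) • x0) (inv W • x0)).
  destruct (success_WPD (last_block b l) b' W sigma (ell - rho - 4 * D - delta) Hs) as [k Hk]; [lra|lra|lra|].
  assert (Htot : total b (l ++ (sigma, b') :: l') = total b l ** (sigma ** W) ** inv (total b l)).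
  { unfold total, W, increments. rewrite map_app, !lprod_app. simpl. rewrite !mulA.
    set (P := b ** lprod _). rewrite <- !(mulA _ b). fold P. now rewrite mulgK. }
  rewrite Htot.
  replace (total b l ** (sigma ** W) ** inv (total b l)) with
    ((total b l ** inv k) ** (k ** (sigma ** W) ** inv k) ** inv (total b l ** inv k)).
  - now apply WPD_conj.
  - now rewrite invM, invK, !mulA, !mulgKV.
Qed.
End Slots.

(** * Expectations over independent slots and blocks *)

Section Blocks.
Variables L m : nat.

(* Expectation over q independent pairs: a slot of L steps followed by a block of m steps. *)
Fixpoint EL (q : nat) (F : list (G * G) -> R) : R :=
  match q with
  | O => F nil
  | S q' => E L (fun sigma => E m (fun b => EL q' (fun l => F ((sigma, b) :: l)%list)))
  end.

Definition supported (l : list (G * G)) : Prop :=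
  List.Forall (fun q => len (fst q) <= C * INR L /\ len (snd q) <= C * INR m) l.

Definition boundedL (q : nat) (F : list (G * G) -> R) (M : R) : Prop :=
  forall l, length l = q -> supported l -> Rabs (F l) <= M.

Lemma boundedL_step q F M sigma b :
  boundedL (S q) F M -> len sigma <= C * INR L -> len b <= C * INR m ->
  boundedL q (fun l => F ((sigma, b) :: l)%list) M.
Proof.
  intros H Hs Hb l Hl Hsup. apply H; [simpl; now rewrite Hl|]. now constructor.
Qed.

Lemma EL_abs q F M : boundedL q F M -> Rabs (EL q F) <= M.
Proof.
  revert F; induction q as [|q IH]; intros F H; [apply H; [easy|constructor]|].
  apply E_abs. intros sigma Hs. apply E_abs. intros b Hb. now apply IH, boundedL_step.
Qed.

Lemma bounded_EL_block q F M sigma :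
  boundedL (S q) F M -> len sigma <= C * INR L ->
  bounded m (fun b => EL q (fun l => F ((sigma, b) :: l)%list)).
Proof. intros H Hs. exists M. intros b Hb. now apply EL_abs, boundedL_step. Qed.

Lemma bounded_EL_slot q F M :
  boundedL (S q) F M ->
  bounded L (fun sigma => E m (fun b => EL q (fun l => F ((sigma, b) :: l)%list))).
Proof.
  intro H. apply bounded_E with M. intros sigma b Hs Hb. now apply EL_abs, boundedL_step.
Qed.

Lemma EL_le q F F' M M' :
  boundedL q F M -> boundedL q F' M' ->
  (forall l, length l = q -> supported l -> F l <= F' l) -> EL q F <= EL q F'.
Proof.
  revert F F'; induction q as [|q IH]; intros F F' H H' Hle; [apply Hle; [easy|constructor]|].
  simpl. apply E_le; [now apply bounded_EL_slot with M|now apply bounded_EL_slot with M'|].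
  intros sigma Hs. apply E_le; [now apply bounded_EL_block with M|now apply bounded_EL_block with M'|].
  intros b Hb. apply IH; try now apply boundedL_step.
  intros l Hl Hsup. apply Hle; [simpl; now rewrite Hl|]. now constructor.
Qed.

Lemma EL_ext q F F' :
  (forall l, length l = q -> F l = F' l) -> EL q F = EL q F'.
Proof.
  revert F F'; induction q as [|q IH]; intros F F' H; [now apply H|].
  simpl. apply E_ext. intros sigma _. apply E_ext. intros b _. apply IH.
  intros l Hl. apply H. simpl. now rewrite Hl.
Qed.

Lemma EL_const q c : EL q (fun _ => c) = c.
Proof.
  induction q as [|q IH]; [easy|]. simpl.
  rewrite (E_ext L _ (fun _ => c)); [apply E_const|]. intros sigma _.
  rewrite (E_ext m _ (fun _ => c)); [apply E_const|]. easy.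
Qed.

Lemma EL_lin q x y F F' M M' :
  boundedL q F M -> boundedL q F' M' ->
  EL q (fun l => x * F l + y * F' l) = x * EL q F + y * EL q F'.
Proof.
  revert F F'; induction q as [|q IH]; intros F F' H H'; [easy|].
  simpl. rewrite <- E_lin by (eapply bounded_EL_slot; eassumption).
  apply E_ext. intros sigma Hs. rewrite <- E_lin by (eapply bounded_EL_block; eassumption).
  apply E_ext. intros b Hb. now apply IH; apply boundedL_step.
Qed.

Lemma E_EL q f : E (q * (L + m)) f = EL q (fun l => f (lprod (increments l))).
Proof.
  revert f; induction q as [|q IH]; intro f; [easy|].
  simpl EL. change (S q * (L + m))%nat with (L + m + q * (L + m))%nat. rewrite !E_add.
  apply E_ext. intros sigma _. apply E_ext. intros b _. now rewrite IH.
Qed.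

Lemma E_EL_swap n q (F : G -> list (G * G) -> R) M :
  (forall g l, len g <= C * INR n -> length l = q -> supported l -> Rabs (F g l) <= M) ->
  E n (fun g => EL q (F g)) = EL q (fun l => E n (fun g => F g l)).
Proof.
  revert F; induction q as [|q IH]; intros F H; [easy|]. simpl.
  assert (Hb : forall g sigma b, len g <= C * INR n -> len sigma <= C * INR L -> len b <= C * INR m ->
    Rabs (EL q (fun l => F g ((sigma, b) :: l)%list)) <= M).
  { intros g sigma b Hg Hs Hb. apply EL_abs. intros l Hl Hsup. apply H; [easy|simpl; now rewrite Hl|now constructor]. }
  rewrite E_swap with (M := M).
  - apply E_ext. intros sigma Hs. rewrite E_swap with (M := M) by auto.
    apply E_ext. intros b Hb'. apply IH. intros g l Hg Hl Hsup.
    apply H; [easy|simpl; now rewrite Hl|now constructor].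
  - intros g sigma Hg Hs. apply E_abs. intros b Hb'. now apply Hb.
Qed.

Variables (c1 : R) (T : list G) (f : G) (alpha : R).
Hypothesis Halpha : 0 < alpha <= 1.
Hypothesis Hsuccess : forall b b', alpha <= E L (indicator (success c1 T f b b')).
Variables (A : R) (k : nat) (eps : R).
Hypothesis Heps : forall y, prob m (fun w => ~ good_block A k y w) <= eps.

(** A count rather than an event: the union bound over junctions becomes linearity of expectation.
    Each block is tested against the inverse of what precedes it, from which it is independent. *)
Fixpoint bad_junctions (b : G) (l : list (G * G)) : R :=
  match l with
  | nil => 0
  | (sigma, b') :: l' =>
      indicator (fun w => ~ good_block A k (inv (b ** sigma) • x0) w) b' + bad_junctions b' l'
  end.

Fixpoint all_fail (b : G) (l : list (G * G)) : R :=
  match l with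
  | nil => 1
  | (sigma, b') :: l' => (1 - indicator (success c1 T f b b') sigma) * all_fail b' l'
  end.

Lemma bad_junctions_range b l : 0 <= bad_junctions b l <= INR (length l).
Proof.
  revert b; induction l as [|[sigma b'] l IH]; intro b; [simpl; lra|].
  change (length ((sigma, b') :: l)) with (S (length l)). rewrite S_INR.
  cbn [bad_junctions]. generalize (IH b')
    (indicator_unit (fun w => ~ good_block A k (inv (b ** sigma) • x0) w) b'). lra.
Qed.

Lemma all_fail_range b l : 0 <= all_fail b l <= 1.
Proof.
  revert b; induction l as [|[sigma b'] l IH]; intro b; [simpl; lra|].
  simpl. generalize (IH b') (indicator_unit (success c1 T f b b') sigma). nra.
Qed.

Lemma bad_junctions_boundedL q b : boundedL q (bad_junctions b) (INR q).
Proof.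
  intros l Hl _. generalize (bad_junctions_range b l). rewrite Hl. intros.
  rewrite Rabs_pos_eq; lra.
Qed.

Lemma all_fail_boundedL q b : boundedL q (all_fail b) 1.
Proof.
  intros l Hl _. generalize (all_fail_range b l). intros. rewrite Rabs_pos_eq; lra.
Qed.

Lemma EL_bad_junctions q b : EL q (bad_junctions b) <= INR q * eps.
Proof.
  revert b; induction q as [|q IH]; intro b; [simpl; lra|].
  rewrite S_INR. simpl EL. assert (Hb := bad_junctions_boundedL (S q) b).
  rewrite <- (E_const L ((INR q + 1) * eps)).
  apply E_le; [exact (bounded_EL_slot q (bad_junctions b) (INR (S q)) Hb)|apply bounded_const|].
  intros sigma Hs.
  set (B := fun w => ~ good_block A k (inv (b ** sigma) • x0) w).
  apply Rle_trans with (E m (fun b' => 1 * indicator B b' + INR q * eps)).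
  - apply E_le; [exact (bounded_EL_block q (bad_junctions b) (INR (S q)) sigma Hb Hs)| |].
    + destruct (bounded_lin m 1 (INR q * eps) (indicator B) (fun _ => 1) (bounded_indicator m B) (bounded_const m 1)) as [M HM].
      exists M. intros g Hg. specialize (HM g Hg). simpl in HM. now rewrite Rmult_1_r in HM.
    + intros b' _. rewrite (EL_ext q _ (fun l => indicator B b' * 1 + 1 * bad_junctions b' l))
        by (intros; unfold B; simpl; lra).
      rewrite EL_lin with (F := fun _ => 1) (M := 1) (M' := INR q), EL_const;
        [generalize (IH b'); lra| |apply bad_junctions_boundedL].
      intros l _ _. rewrite Rabs_R1. lra.
  - rewrite E_affine by apply bounded_indicator. generalize (Heps (inv (b ** sigma) • x0)).
    unfold prob, B. lra.
Qed.

(** The slot is drawn before the block [b'] on which its success also depends. Exchanging the two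
    expectations averages the slot last, with both neighbours fixed, and yields a factor at most 1 -
    alpha. *)
Lemma EL_all_fail q b : EL q (all_fail b) <= (1 - alpha) ^ q.
Proof.
  revert b; induction q as [|q IH]; intro b; [simpl; lra|]. simpl EL.
  set (Phi := fun b' => EL q (all_fail b')).
  assert (HPhi : forall b', 0 <= Phi b' <= (1 - alpha) ^ q).
  { intro b'. split; [|apply IH]. rewrite <- (EL_const q 0).
    apply EL_le with (M := 0) (M' := 1).
    - intros l _ _. rewrite Rabs_R0. lra.
    - apply all_fail_boundedL.
    - intros l _ _. apply all_fail_range. }
  assert (Hone : (1 - alpha) ^ q <= 1) by (generalize (pow_incr (1 - alpha) 1 q ltac:(lra)); rewrite pow1; lra).
  rewrite (E_ext L _ (fun sigma => E m (fun b' => (1 - indicator (success c1 T f b b') sigma) * Phi b'))).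
  2: { intros sigma _. apply E_ext. intros b' _. unfold Phi.
       rewrite (EL_ext q _ (fun l => (1 - indicator (success c1 T f b b') sigma) * all_fail b' l + 0 * all_fail b' l))
         by (intros; simpl; lra).
       rewrite EL_lin with (M := 1) (M' := 1); [lra| |]; apply all_fail_boundedL. }
  rewrite E_swap with (M := 1).
  2: { intros sigma b' _ _. generalize (HPhi b') (indicator_unit (success c1 T f b b') sigma).
       intros. rewrite Rabs_pos_eq; nra. }
  rewrite <- (E_const m ((1 - alpha) ^ S q)).
  assert (Hval : forall b', E L (fun sigma => (1 - indicator (success c1 T f b b') sigma) * Phi b') =
     Phi b' * (1 - E L (indicator (success c1 T f b b')))).
  { intro b'. rewrite (E_ext L _ (fun sigma => - Phi b' * indicator (success c1 T f b b') sigma + Phi b'))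
      by (intros; ring). rewrite E_affine by apply bounded_indicator. ring. }
  apply E_le; [|apply bounded_const|].
  - apply bounded_E with (M := 1). intros b' sigma _ _.
    generalize (HPhi b') (indicator_unit (success c1 T f b b') sigma).
    intros. rewrite Rabs_pos_eq; nra.
  - intros b' _. rewrite Hval. simpl (_ ^ S q). generalize (HPhi b') (Hsuccess b b'). intros H1 H2.
    assert (H3 : 0 <= 1 - E L (indicator (success c1 T f b b'))).
    { assert (E L (indicator (success c1 T f b b')) <= E L (fun _ => 1)); [|rewrite E_const in *; lra].
      apply E_le; [apply bounded_indicator|apply bounded_const|]. intros; apply indicator_unit. }
    rewrite Rmult_comm. apply Rmult_le_compat; lra.
Qed.

Variable m0 : nat.
Hypothesis Heps0 : forall y, prob m0 (fun w => ~ good_block A k y w) <= eps.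
Hypothesis Hgeom : forall b l sigma b' l',
  good_chain (C * INR L) (1/8 * A * INR k) (9/10 * A * INR k) b (l ++ (sigma, b') :: l') ->
  good_block A k (inv (last_block b (l ++ (sigma, b') :: l')) • x0) b ->
  success c1 T f (last_block b l) b' sigma ->
  isWPD (total b (l ++ (sigma, b') :: l')).

Lemma good_chain_or_bad b l :
  supported l ->
  good_chain (C * INR L) (1/8 * A * INR k) (9/10 * A * INR k) b l \/ 1 <= bad_junctions b l.
Proof.
  revert b; induction l as [|[sigma b'] l IH]; intros b Hl; [now left|].
  apply List.Forall_cons_iff in Hl. destruct Hl as [[Hs _] Hl].
  cbn [bad_junctions good_chain]. generalize (bad_junctions_range b' l). intro Hr.
  destruct (classic (good_block A k (inv (b ** sigma) • x0) b')) as [Hg|Hg].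
  - rewrite (indicator_out (fun w => ~ good_block A k (inv (b ** sigma) • x0) w)) by tauto.
    destruct (IH b' Hl) as [H|H]; [left|right; lra].
    split; [|easy]. destruct Hg as [Hg1 Hg2]. now split.
  - right. rewrite (indicator_in (fun w => ~ good_block A k (inv (b ** sigma) • x0) w)) by easy. lra.
Qed.

Lemma success_or_all_fail b l :
  all_fail b l = 1 \/ exists l1 sigma b' l2, l = (l1 ++ (sigma, b') :: l2)%list /\
    success c1 T f (last_block b l1) b' sigma.
Proof.
  revert b; induction l as [|[sigma b'] l IH]; intro b; [now left|].
  destruct (classic (success c1 T f b b' sigma)) as [Hs|Hs].
  - right. exists nil, sigma, b', l. split; [easy|exact Hs].
  - simpl. rewrite (indicator_out _ _ Hs). destruct (IH b') as [->|(l1 & s1 & b1 & l2 & -> & H)].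
    + left. lra.
    + right. exists ((sigma, b') :: l1)%list, s1, b1, l2. split; [easy|].
      unfold last_block. simpl map. now rewrite last_cons.
Qed.

Lemma prob_not_WPD q :
  prob (m0 + q * (L + m)) (fun w => ~ isWPD w) <= (INR q + 1) * eps + (1 - alpha) ^ q.
Proof.
  unfold prob. rewrite E_add.
  rewrite (E_ext m0 _ (fun b => EL q (fun l => indicator (fun w => ~ isWPD w) (total b l))))
    by (intros b _; now rewrite E_EL).
  (* With default [e] instead of [b] the base point does not depend on [b], so [b] can be averaged
     last. On the empty list, where the default is seen, [all_fail] is 1 and the bound below is
     trivial. *)
  set (cyc := fun b l => indicator (fun w => ~ good_block A k (inv (last_block e l) • x0) w) b).
  assert (Hcyc : forall b l, 0 <= cyc b l <= 1) by (intros; apply indicator_unit).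
  assert (Hcycb : forall b, boundedL q (cyc b) 1).
  { intros b l _ _. rewrite Rabs_pos_eq; apply Hcyc. }
  assert (Hsumb : forall b, boundedL q (fun l => 1 * cyc b l + 1 * all_fail b l) 2).
  { intros b l _ _. generalize (Hcyc b l) (all_fail_range b l). intros. rewrite Rabs_pos_eq; lra. }
  assert (Hpt : forall b, EL q (fun l => indicator (fun w => ~ isWPD w) (total b l)) <=
     EL q (bad_junctions b) + (EL q (cyc b) + EL q (all_fail b))).
  { intro b. apply Rle_trans with
      (EL q (fun l => 1 * bad_junctions b l + 1 * (1 * cyc b l + 1 * all_fail b l))).
    - apply EL_le with (M := 1) (M' := INR q + 2).
      + intros l _ _. rewrite Rabs_pos_eq; apply indicator_unit.
      + intros l Hl _. generalize (bad_junctions_range b l) (Hcyc b l) (all_fail_range b l).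
        rewrite Hl. intros. rewrite Rabs_pos_eq; lra.
      + intros l Hl Hsup.
        generalize (bad_junctions_range b l) (Hcyc b l) (all_fail_range b l)
          (indicator_unit (fun w => ~ isWPD w) (total b l)). intros R1 R2 R3 R4.
        destruct (good_chain_or_bad b l Hsup) as [Hg|Hg]; [|lra].
        destruct (success_or_all_fail b l) as [Hs|(l1 & sigma & b' & l2 & El & Hs)]; [lra|].
        destruct (classic (good_block A k (inv (last_block e l) • x0) b)) as [Hc|Hc].
        * rewrite indicator_out; [lra|]. intro Hno. apply Hno. subst l.
          apply Hgeom; try assumption. revert Hc. unfold last_block. rewrite !map_app. cbn [map]. now rewrite !last_app_cons.
        * unfold cyc at 1. rewrite (indicator_in (fun w => ~ good_block A k (inv (last_block e l) • x0) w)) by easy.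
          lra.
    - rewrite EL_lin with (M := INR q) (M' := 2); [|apply bad_junctions_boundedL|apply Hsumb].
      rewrite EL_lin with (M := 1) (M' := 1); [lra|apply Hcycb|apply all_fail_boundedL]. }
  assert (Hbc : bounded m0 (fun b => EL q (cyc b))).
  { exists 1. intros b _. apply EL_abs, Hcycb. }
  apply Rle_trans with (E m0 (fun b => 1 * EL q (cyc b) + (INR q * eps + (1 - alpha) ^ q))).
  - apply E_le.
    + exists 1. intros b _. apply EL_abs. intros l _ _. rewrite Rabs_pos_eq; apply indicator_unit.
    + destruct (bounded_lin m0 1 (INR q * eps + (1 - alpha) ^ q) _ (fun _ => 1) Hbc (bounded_const m0 1)) as [M HM].
      exists M. intros g Hg. specialize (HM g Hg). simpl in HM. now rewrite Rmult_1_r in HM.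
    + intros b _. generalize (Hpt b) (EL_bad_junctions q b) (EL_all_fail q b). lra.
  - rewrite E_affine by exact Hbc. rewrite E_EL_swap with (M := 1).
    2: { intros g l _ _ _. rewrite Rabs_pos_eq; apply Hcyc. }
    assert (EL q (fun l => E m0 (fun g => cyc g l)) <= eps); [|lra].
    rewrite <- (EL_const q eps). apply EL_le with (M := 1) (M' := Rabs eps).
    + intros l _ _. apply E_abs. intros b _. rewrite Rabs_pos_eq; apply Hcyc.
    + intros l _ _. apply Rle_refl.
    + intros l _ _. apply Heps0.
Qed.
End Blocks.

(** * Choice of the constants and the final rate *)

Lemma prob_not n B : prob n (fun g => ~ B g) = 1 - prob n B.
Proof.
  unfold prob. rewrite (E_ext n _ (fun g => -1 * indicator B g + 1)).
  - rewrite E_affine by apply bounded_indicator. lra.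
  - intros g _. destruct (classic (B g)) as [H|H].
    + rewrite (indicator_in B) by easy. rewrite indicator_out by tauto. lra.
    + rewrite (indicator_out B) by easy. rewrite indicator_in by easy. lra.
Qed.

Lemma prob_le_1 n B : prob n B <= 1.
Proof.
  rewrite <- (E_const n 1). apply E_le; [apply bounded_indicator|apply bounded_const|].
  intros; apply indicator_unit.
Qed.

Lemma prob_not_WPD_blocks g h f0 Lg Lh Lf :
  lox g -> lox h -> disjoint_fixed X d G mul inv e act x0 g h -> isWPD f0 ->
  reach Lg g -> reach Lh h -> reach Lf f0 -> (1 <= Lg)%nat -> (1 <= Lh)%nat ->
  exists (N L k0 : nat) (K tau alpha : R), (1 <= N)%nat /\ 0 < K /\ 0 < tau /\ 0 < alpha <= 1 /\
    forall k q m0, (k0 <= k)%nat -> (k * N <= m0 <= 3 * k * N)%nat ->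
      prob (m0 + q * (L + k * N)) (fun w => ~ isWPD w) <=
      (INR q + 1) * (K * exp (- tau * INR k)) + (1 - alpha) ^ q.
Proof.
  intros Hg Hh Hdis Hf0 Rg Rh Rf HLg HLh. assert (Hd := delta_nonneg). assert (HC := C_nonneg).
  assert (Hpairs := pingpong_exists g h Lg Lh Hg Hh Hdis Rg Rh HLg HLh).
  destruct (uniform_drift Hpairs) as [N [HA1 Hdrift]]. set (A := E N len) in *.
  destruct (good_block_prob N A eq_refl HA1 Hdrift) as [K [tau [HK [Htau Hgood]]]].
  destruct Hpairs as [c [Hc Hp]].
  destruct (Hp (2 * c + 4 * delta + 1)) as [a [b [La [Hab [Ra Rb]]]]].
  set (T := two_letter_words a b). set (c1 := c + 3 * delta).
  set (Kw := 2 * (len a + len b)). set (r := c1 + delta + 2 * Kw).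
  assert (Hc1 : 0 <= c1) by (unfold c1; lra).
  assert (HKw : 0 <= Kw) by (unfold Kw; generalize (len_nonneg a) (len_nonneg b); lra).
  assert (Hr : 0 <= r) by (unfold r; lra).
  assert (HT : forall y z, exists u, In u T /\ gp y (u • z) <= c1).
  { intros y z.
    destruct (two_letter_word_spec c (2 * c + 4 * delta + 1) a b y z ltac:(lra) Hab) as [u [Hu [H1 _]]].
    now exists u. }
  assert (HTw : forall u, In u T -> len u <= Kw /\ reach (La + La) u).
  { intros u Hu. unfold Kw. generalize (len_nonneg a) (len_nonneg b). intros.
    unfold T, two_letter_words in Hu. simpl in Hu. destruct Hu as [<-|[<-|[<-|[<-|[]]]]];
    (split; [|now apply reach_mul]).
    - generalize (lenM a a). lra.
    - generalize (lenM a b). lra.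
    - generalize (lenM b a). lra.
    - generalize (lenM b b). lra. }
  destruct (WPD_power_finite f0 (2 * (r + 4 * delta) + 1 + 2 * delta) Hf0 ltac:(lra)) as [M0 HM0].
  destruct (lox_length f0 (proj1 Hf0)) as [l [cl [Hl [_ Hlen]]]].
  destruct (archimed_nat ((2 * r + 3 * delta + 1) / l)) as [M1 HM1].
  (* [M0] gives the finite stabiliser and [M1] the length. Both depend on [r], hence on the letters
     only, and not on the slot length [L], which is fixed afterwards. *)
  set (M := (M0 + M1)%nat). set (f := pow f0 M).
  assert (Hflen : 2 * r + 3 * delta + 1 <= len f).
  { apply Rle_trans with (2 := proj1 (Hlen M)).
    assert (INR M1 <= INR M) by (apply le_INR; unfold M; lia).
    apply Rmult_le_compat_l with (r := l) in HM1; [|lra].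
    replace (l * ((2 * r + 3 * delta + 1) / l)) with (2 * r + 3 * delta + 1) in HM1 by (field; lra).
    assert (l * INR M1 <= l * INR M) by (apply Rmult_le_compat_l; lra). lra. }
  assert (Hffin := HM0 M ltac:(unfold M; lia)). fold f in Hffin.
  set (L := (La + La + M * Lf + (La + La))%nat).
  destruct (success_prob c1 T f HT L) as [alpha [Halpha Hsucc]].
  { intros u u' Hu Hu'. apply reach_mul; [apply reach_mul|]; [now apply HTw|now apply reach_pow|now apply HTw]. }
  set (D := C * INR L). assert (HD : 0 <= D) by (apply Rmult_le_pos; [easy|apply pos_INR]).
  (* The chain conditions require (9/10 - 2/8) A k and (9/10 - 1/8) A k to beat the constants; both
     coefficients exceed 1/2, hence the factor 2, and A >= 1. *)
  destruct (archimed_nat (2 * (5 * D + 6 * delta + 2 * r + 1 + 2 * Kw) + 1)) as [k0 Hk0].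
  exists N, L, k0, K, tau, alpha.
  split; [now apply (N_pos N A)|]. split; [easy|split; [easy|split; [easy|]]].
  intros k q m0 Hk Hm0.
  apply (prob_not_WPD L (k * N) c1 T f alpha Halpha Hsucc A k).
  - intro y. apply Hgood. lia.
  - intro y. now apply Hgood.
  - intros b1 l1 sigma b' l2 Hchain [Hb1 Hcyc] Hs.
    apply le_INR in Hk. assert (HAk : INR k <= A * INR k) by (generalize (pos_INR k); nra).
    apply (good_chain_WPD c1 T f Kw Hc1 HT (fun u Hu => proj1 (HTw u Hu)) Hflen Hffin
      D (1/8 * A * INR k) (9/10 * A * INR k)); auto; fold r; lra.
Qed.

(** Absorbs the number of junctions, at most quadratic in k, at the price of half the rate [tau]. *)
Lemma exp_square_bound tau x : 0 < tau -> 0 <= x -> x ^ 2 <= 16 / tau ^ 2 * exp (tau * x / 2).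
Proof.
  intros Ht Hx.
  assert (H : tau * x / 4 <= exp (tau * x / 4)) by (generalize (exp_ineq1_le (tau * x / 4)); lra).
  assert (H0 : 0 <= tau * x / 4) by nra.
  replace (exp (tau * x / 2)) with (exp (tau * x / 4) * exp (tau * x / 4))
    by (rewrite <- exp_plus; f_equal; field).
  assert (H1 : (tau * x / 4) * (tau * x / 4) <= exp (tau * x / 4) * exp (tau * x / 4))
    by (apply Rmult_le_compat; lra).
  assert (Hp : 0 < 16 / tau ^ 2) by (apply Rdiv_lt_0_compat; [lra|nra]).
  apply Rmult_le_compat_l with (r := 16 / tau ^ 2) in H1; [|lra].
  replace (16 / tau ^ 2 * (tau * x / 4 * (tau * x / 4))) with (x ^ 2) in H1 by (field; lra). lra.
Qed.

Lemma pow_le_exp alpha q : 0 < alpha <= 1 -> (1 - alpha) ^ q <= exp (- alpha * INR q).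
Proof.
  intro Ha. induction q as [|q IH]; [simpl; rewrite Rmult_0_r, exp_0; lra|].
  rewrite S_INR. replace (- alpha * (INR q + 1)) with (- alpha + - alpha * INR q) by ring.
  rewrite exp_plus. simpl (_ ^ S q). apply Rmult_le_compat; [lra|apply pow_le; lra| |easy].
  generalize (exp_ineq1_le (- alpha)). lra.
Qed.

(* With k = sqrt n, the n steps contain about sqrt n blocks of length about sqrt n. *)
Lemma prob_not_WPD_sqrt g h f0 Lg Lh Lf :
  lox g -> lox h -> disjoint_fixed X d G mul inv e act x0 g h -> isWPD f0 ->
  reach Lg g -> reach Lh h -> reach Lf f0 -> (1 <= Lg)%nat -> (1 <= Lh)%nat ->
  exists B c, 0 < B /\ 0 < c < 1 /\
    forall n, prob n (fun w => ~ isWPD w) <= B * Rpower c (sqrt (INR n)).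
Proof.
  intros Hg Hh Hdis Hf0 Rg Rh Rf HLg HLh.
  destruct (prob_not_WPD_blocks g h f0 Lg Lh Lf Hg Hh Hdis Hf0 Rg Rh Rf HLg HLh)
    as (N & L & k1 & K & tau & alpha & HN & HK & Htau & Halpha & Hmain).
  set (k0 := (k1 + N + L)%nat).
  assert (HN' : 1 <= INR N) by (change 1 with (INR 1); now apply le_INR).
  (* tau / 2 is what remains after the number of junctions is absorbed; alpha / (N + 1) appears
     because there are about k / (N + 1) slots. *)
  set (lam := Rmin (tau / 2) (alpha / (INR N + 1))).
  assert (Hlam : 0 < lam) by (apply Rmin_glb_lt; apply Rdiv_lt_0_compat; lra).
  assert (Hlam1 : lam <= tau / 2) by apply Rmin_l.
  assert (Hlam2 : lam <= alpha / (INR N + 1)) by apply Rmin_r.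
  set (B1 := K * (16 / tau ^ 2) * exp (tau / 2) + exp (2 * alpha)).
  assert (HB1 : 0 < B1).
  { apply Rplus_lt_0_compat; [|apply exp_pos]. apply Rmult_lt_0_compat; [|apply exp_pos].
    apply Rmult_lt_0_compat; [easy|]. apply Rdiv_lt_0_compat; [lra|]. now apply pow_lt. }
  exists ((B1 + exp (lam * INR k0)) * exp lam), (exp (- lam)).
  assert (Hk0p := exp_pos (lam * INR k0)).
  split; [apply Rmult_lt_0_compat; [lra|apply exp_pos]|].
  split; [split; [apply exp_pos|rewrite <- exp_0; apply exp_increasing; lra]|].
  intro n. set (k := Nat.sqrt n).
  assert (Hsq := Nat.sqrt_spec n (Nat.le_0_l n)). fold k in Hsq.
  assert (Hpow : exp (- lam * INR k) <= exp lam * Rpower (exp (- lam)) (sqrt (INR n))).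
  { unfold Rpower. rewrite ln_exp, <- exp_plus. apply exp_le_mono.
    assert (Hs : sqrt (INR n) <= INR k + 1).
    { rewrite <- S_INR, <- (sqrt_square (INR (S k))) by apply pos_INR.
      apply sqrt_le_1_alt. rewrite <- mult_INR. apply le_INR. lia. }
    nra. }
  assert (Hgoal : prob n (fun w => ~ isWPD w) <= (B1 + exp (lam * INR k0)) * exp (- lam * INR k)).
  2: { rewrite Rmult_assoc. apply Rle_trans with (1 := Hgoal). apply Rmult_le_compat_l; [lra|easy]. }
  assert (Hkp := exp_pos (- lam * INR k)).
  destruct (le_lt_dec k0 k) as [Hk|Hk].
  (* For small [k] the summand exp(lam k0) of the constant makes the bound at least 1. *)
  2: { apply Rle_trans with (1 := prob_le_1 n _).
       assert (Hone : 1 <= exp (lam * INR k0) * exp (- lam * INR k)).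
       { rewrite <- exp_plus, <- exp_0. apply exp_le_mono.
         assert (INR k <= INR k0) by (apply le_INR; lia). nra. }
       nra. }
  unfold k0 in Hk.
  set (q := ((n - k * N) / (L + k * N))%nat).
  (* The first block absorbs the remainder, so the decomposition of [n] is exact. The remainder is
     below L + kN <= 2kN, whence m0 <= 3kN. *)
  set (m0 := (k * N + (n - k * N) mod (L + k * N))%nat).
  assert (Hkn : (k * N <= n)%nat) by nia.
  assert (Hpos : (0 < L + k * N)%nat) by nia.
  assert (Hdm := Nat.div_mod_eq (n - k * N) (L + k * N)). fold q in Hdm.
  assert (Hmod := Nat.mod_upper_bound (n - k * N) (L + k * N) ltac:(lia)).
  assert (Hn : n = (m0 + q * (L + k * N))%nat) by (unfold m0; nia).
  assert (HLk : (L <= k * N)%nat) by nia.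
  assert (Hb := Hmain k q m0 ltac:(lia) ltac:(unfold m0; nia)). rewrite <- Hn in Hb.
  assert (Hq1 : INR q + 1 <= (INR k + 1) ^ 2).
  { simpl. rewrite Rmult_1_r, <- !S_INR, <- mult_INR. apply le_INR.
    assert (q <= n)%nat; [|lia]. rewrite Hn. nia. }
  (* Uses k^2 <= n and L <= k, so that a slot with its block takes at most k (N + 1) steps; the
     terms [N] and [q + 1] lead to the factor exp(2 alpha). *)
  assert (Hq2 : (k <= N + (q + 1) * (N + 1))%nat).
  { assert (Hlt : (n - k * N < (q + 1) * (k * (N + 1)))%nat) by nia.
    assert (Hk1 : (0 < k)%nat) by lia.
    assert (Hlt' : (k * k < k * (N + (q + 1) * (N + 1)))%nat) by nia. nia. }
  assert (H1 : (INR q + 1) * (K * exp (- tau * INR k)) <=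
    K * (16 / tau ^ 2) * exp (tau / 2) * exp (- lam * INR k)).
  { apply Rle_trans with ((16 / tau ^ 2 * exp (tau * (INR k + 1) / 2)) * (K * exp (- tau * INR k))).
    - apply Rmult_le_compat_r; [left; apply Rmult_lt_0_compat; [easy|apply exp_pos]|].
      apply Rle_trans with (1 := Hq1). apply exp_square_bound; [easy|]. generalize (pos_INR k); lra.
    - assert (Hexp : exp (tau * (INR k + 1) / 2) * exp (- tau * INR k) <= exp (tau / 2) * exp (- lam * INR k)).
      { rewrite <- !exp_plus. apply exp_le_mono. generalize (pos_INR k). nra. }
      assert (Hc0 : 0 < K * (16 / tau ^ 2)).
      { apply Rmult_lt_0_compat; [easy|]. apply Rdiv_lt_0_compat; [lra|]. now apply pow_lt. }
      apply Rmult_le_compat_l with (r := K * (16 / tau ^ 2)) in Hexp; lra. }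
  assert (H2 : (1 - alpha) ^ q <= exp (2 * alpha) * exp (- lam * INR k)).
  { apply Rle_trans with (1 := pow_le_exp alpha q Halpha). rewrite <- exp_plus. apply exp_le_mono.
    apply le_INR in Hq2. rewrite plus_INR, mult_INR, !plus_INR in Hq2. change (INR 1) with 1 in Hq2.
    set (al := alpha / (INR N + 1)) in *.
    assert (Hal : al * (INR N + 1) = alpha) by (unfold al; field; lra).
    assert (Hal0 : 0 < al) by lra.
    assert (Hlk : lam * INR k <= al * INR k) by (apply Rmult_le_compat_r; [apply pos_INR|easy]).
    assert (Hak : al * INR k <= al * (INR N + (INR q + 1) * (INR N + 1))) by (apply Rmult_le_compat_l; lra).
    assert (al * ((INR q + 1) * (INR N + 1)) = alpha * (INR q + 1)) by (rewrite <- Hal; ring).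
    lra. }
  unfold B1. nra.
Qed.

End Walk.
End HyperbolicAction.

Theorem theorem1p10
  (X : Type) (d : X -> X -> R) (delta : R)
  (Hmet : is_metric X d) (Hgeo : geodesic_space X d) (Hhyp : hyperbolic X d delta)
  (G : Type) (mul : G -> G -> G) (inv : G -> G) (e : G)
  (Hgrp : is_group G mul inv e)
  (act : G -> X -> X) (Hact : isometric_action X d G mul e act)
  (x0 : X) (s : nat -> G) (p : nat -> R)
  (Hmu : prob_measure G s p)
  (Hne : non_elementary X d G mul inv e act x0 s p)
  (Hbd : bounded_measure X d G act x0 s p)
  (Hwpd : WPD_measure X d G mul e act x0 s p) :
  exists B c : R, 0 < B /\ 0 < c < 1 /\
    forall (n : nat) (r : R),
      walk_prob G mul e s p n (WPD X d G mul e act x0) r ->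
      r >= 1 - B * Rpower c (sqrt (INR n)).
Proof.
  destruct Hmu as [Hp0 Hp1]. destruct Hbd as [C0 HC0].
  destruct Hne as (g & h & Gg & Gh & Hg & Hh & Hdis). destruct Hwpd as (f & Gf & Hf).
  (* Atoms of weight 0 are moved to the identity, so that all increments are bounded. *)
  set (s' := fun i => if Rlt_dec 0 (p i) then s i else e).
  assert (Hs : forall i, p i = 0 \/ s' i = s i).
  { intro i. unfold s'. destruct (Rlt_dec 0 (p i)) as [H|H]; [now right|left].
    generalize (Hp0 i). lra. }
  assert (HsC : forall i, len X d G act x0 (s' i) <= Rmax 0 C0).
  { intro i. unfold s'. destruct (Rlt_dec 0 (p i)) as [H|H].
    - apply Rle_trans with (2 := Rmax_r _ _). apply HC0. now exists i.
    - rewrite (len1 X d Hmet G mul e act Hact x0). apply Rmax_l. }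
  assert (Hr : forall g, Gamma G mul s p g ->
    exists L, (1 <= L)%nat /\ reach X d G mul e act x0 s' p (Rmax 0 C0) L g).
  { intros u Hu. now apply (Gamma_reach X d Hmet G mul inv e Hgrp act Hact x0 s' p _ Hp0 Hp1 HsC s). }
  destruct (Hr g Gg) as [Lg [HLg Rg]]. destruct (Hr h Gh) as [Lh [HLh Rh]].
  destruct (Hr f Gf) as [Lf [_ Rf]].
  destruct (prob_not_WPD_sqrt X d delta Hmet Hhyp G mul inv e Hgrp act Hact x0 s' p (Rmax 0 C0)
    Hp0 Hp1 HsC g h f Lg Lh Lf Hg Hh Hdis Hf Rg Rh Rf HLg HLh) as (B & c & HB & Hc & Hbound).
  exists B, c. split; [easy|split; [easy|]]. intros n r Hwalk.
  rewrite (walk_prob_E G mul e s' p s n _ r Hs Hwalk).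
  assert (Hnot := prob_not X d Hmet G mul e act Hact x0 s' p (Rmax 0 C0) Hp0 Hp1 HsC n
    (WPD X d G mul e act x0)).
  specialize (Hbound n). unfold prob in Hnot at 2. lra.
Qed.
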